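(* Let $X$ be a Cantor set with Borel $\sigma$-algebra $\mathcal B$. The topological groups $(Aut(X,\mathcal B),\tau)$ and $(Homeo(X),\tau)$ possess the Rokhlin property; that is, each of these groups contains an element whose conjugacy class is $\tau$-dense in the group.
   Context: $X$ is a Cantor set and $\mathcal B$ its $\sigma$-algebra of Borel sets. $Aut(X,\mathcal B)$ is the group of all Borel bijections of $X$ onto itself, and $Homeo(X)$ is its subgroup of all homeomorphisms of $X$. For $S,T\in Aut(X,\mathcal B)$ put $E(S,T)=\{x\in X: Sx\ne Tx\}$. The uniform topology $\tau$ on $Aut(X,\mathcal B)$ has as a base the sets $$U(T;\mu_1,\ldots,\mu_n;\varepsilon)=\{S\in Aut(X,\mathcal B):\mu_i(E(S,T))<\varepsilon,\ i=1,\ldots,n\},$$ where $T\in Aut(X,\mathcal B)$, $\mu_1,\ldots,\mu_n$ are Borel probability measures on $X$, and $\varepsilon>0$. The induced topology on $Homeo(X)$ is also denoted $\tau$. A topological group $G$ possesses the Rokhlin property if there is an element $g\in G$ whose conjugacy class $\{hgh^{-1}:h\in G\}$ is dense in $G$. *)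

(* Defs.v *)
From HB Require Import structures.
From mathcomp Require Import all_boot all_order all_algebra.
From mathcomp Require Import all_classical all_reals all_analysis.

Set Implicit Arguments.
Unset Strict Implicit.
Unset Printing Implicit Defensive.

Import Order.TTheory GRing.Theory Num.Theory.

Local Open Scope classical_set_scope.
Local Open Scope group_scope.

HB.structure Definition PreTopologicalGroup := {G of Topological G & Group G}.

HB.mixin Record PreTopologicalGroup_isTopologicalGroup G
    of PreTopologicalGroup G := {
  mulg_continuous : continuous (fun x : G * G => x.1 * x.2) ;
  invg_continuous : continuous (fun x : G => x^-1)
}.

#[short(type="topologicalGroupType")]
HB.structure Definition TopologicalGroup :=
  {G of PreTopologicalGroup G & PreTopologicalGroup_isTopologicalGroup G}.

Definition conjugacy_class (G : groupType) (g : G) : set G :=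
  [set h * g * h^-1 | h in [set: G]].

Definition rokhlin_property (G : topologicalGroupType) : Prop :=
  exists g : G, dense (conjugacy_class g).

(* cantor_like alone would not do: without metrizability it also holds of
   2 ^ I for uncountable I. *)
HB.mixin Record isCantorSet X of PointedTopological X := {
  cantor_homeomorphism : exists (f : X -> cantor_space) (g : cantor_space -> X),
    [/\ cancel f g, cancel g f, continuous f & continuous g]
}.

#[short(type="cantorSetType")]
HB.structure Definition CantorSet := {X of PointedTopological X & isCantorSet X}.

Fact cantor_space_isCantorSet :
  exists (f : cantor_space -> cantor_space) (g : cantor_space -> cantor_space),
    [/\ cancel f g, cancel g f, continuous f & continuous g].
Proof. by exists id, id; split=> // x; apply: cvg_id. Qed.

HB.instance Definition _ := isCantorSet.Build cantor_space cantor_space_isCantorSet.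

Notation borel X := (g_sigma_algebraType (@open X)).

(* Over a Cantor set the measurability of the inverse is automatic (a Borel
   bijection of a standard Borel space has a Borel inverse). *)
Record borelAut (X : ptopologicalType) := BorelAut {
  aut_fun :> X -> X ;
  aut_inv : X -> X ;
  aut_funK : cancel aut_fun aut_inv ;
  aut_invK : cancel aut_inv aut_fun ;
  aut_measurable : measurable_fun [set: borel X] (aut_fun : borel X -> borel X) ;
  inv_measurable : measurable_fun [set: borel X] (aut_inv : borel X -> borel X)
}.
Section BorelAutGroup.
Context {X : ptopologicalType}.
Implicit Types S T : borelAut X.

Lemma borelAut_eq S T : aut_fun S =1 aut_fun T -> S = T.
Proof.
case: S T => [f f' fK f'K mf mf'] [g g' gK g'K mg mg'] /= /funext fg.
subst g.
have fg' : f' = g' by apply/funext => x; rewrite -{1}(g'K x) fK.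
by subst g'; congr BorelAut; exact: Prop_irrelevance.
Qed.

Definition aut1 : borelAut X := @BorelAut X id id
  (fun=> erefl) (fun=> erefl) (@measurable_id _ _ _) (@measurable_id _ _ _).

Definition autV T : borelAut X :=
  BorelAut (aut_invK T) (aut_funK T) (inv_measurable T) (aut_measurable T).

Definition autM S T : borelAut X := @BorelAut X (S \o T) (aut_inv T \o aut_inv S)
  (can_comp (aut_funK S) (aut_funK T)) (can_comp (aut_invK T) (aut_invK S))
  (measurableT_comp (aut_measurable S) (aut_measurable T))
  (measurableT_comp (inv_measurable T) (inv_measurable S)).

End BorelAutGroup.

HB.instance Definition _ (X : ptopologicalType) := gen_eqMixin (borelAut X).
HB.instance Definition _ (X : ptopologicalType) := gen_choiceMixin (borelAut X).

Section BorelAutIsGroup.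
Context (X : ptopologicalType).

Fact autMA : associative (@autM X).
Proof. by move=> S T U; exact: borelAut_eq. Qed.
Fact aut1M : left_id aut1 (@autM X).
Proof. by move=> S; exact: borelAut_eq. Qed.
Fact autM1 : right_id aut1 (@autM X).
Proof. by move=> S; exact: borelAut_eq. Qed.
Fact autVM : left_inverse aut1 autV (@autM X).
Proof. by move=> S; apply: borelAut_eq => x /=; rewrite aut_funK. Qed.
Fact autMV : right_inverse aut1 autV (@autM X).
Proof. by move=> S; apply: borelAut_eq => x /=; rewrite aut_invK. Qed.

HB.instance Definition _ :=
  isGroup.Build (borelAut X) autMA aut1M autM1 autVM autMV.

End BorelAutIsGroup.

Definition disagreement (X : ptopologicalType) (S T : borelAut X) : set (borel X) :=
  [set x | S x <> T x].

Definition unif_nbhd (R : realType) (X : ptopologicalType) (T : borelAut X)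
    (n : nat) (mu : 'I_n.+1 -> probability (borel X) R) (e : R) : set (borelAut X) :=
  [set S | forall i, (mu i (disagreement S T) < e%:E)%E].

(* Aut(X, B) with the uniform topology; R only fixes the field of real values
   of the measures, and is recorded in the type so that the topology can be
   inferred from it. *)
Definition unifAut (R : realType) (X : ptopologicalType) : Type := borelAut X.

HB.instance Definition _ (R : realType) (X : ptopologicalType) :=
  Group.on (unifAut R X).

Definition unif_base (R : realType) (X : ptopologicalType) :
    set (set (unifAut R X)) :=
  [set U | exists (T : borelAut X) (n : nat)
      (mu : 'I_n.+1 -> probability (borel X) R) (e : R),
    (0 < e)%R /\ U = unif_nbhd T mu e].

Section UniformTopology.
Context {R : realType} {X : cantorSetType}.
Implicit Types S T U : borelAut X.

Lemma disagreement_measurable S T : measurable (disagreement S T).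
Proof.
have [f [g [fK gK cf cg]]] := @cantor_homeomorphism X.
pose B (n : nat) : set (borel X) := [set x | f x n].
have oB n : open (B n : set X).
  have -> : B n = (fun x : X => f x n) @^-1` [set true] by [].
  apply: open_comp; last exact: discrete_open.
  move=> x _; apply: (@continuous_comp _ _ _ f (fun y : cantor_space => y n)).
    exact: cf.
  exact: (@proj_continuous nat (fun=> bool) n).
have mB n : measurable (B n) by exact: sub_sigma_algebra.
have mp (V : borelAut X) n : measurable ((V : borel X -> borel X) @^-1` B n).
  by rewrite -[X in measurable X]setTI; by apply: (aut_measurable V).
have -> : disagreement S T = \bigcup_n
    ((S @^-1` B n `\` T @^-1` B n) `|` (T @^-1` B n `\` S @^-1` B n)).
  apply/seteqP; split=> [x /= neq|x [n _ /= [[]|[]]]]; last 2 first.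
  - by rewrite /B /disagreement /= => + + eST; rewrite eST.
  - by rewrite /B /disagreement /= => + + eST; rewrite eST.
  apply: contrapT => nex; apply: neq; apply: (can_inj fK).
  apply/funext => n; apply/idP/idP => h; apply: contrapT => nh; apply: nex.
    by exists n => //; left.
  by exists n => //; right.
apply: bigcupT_measurable => n.
by apply: measurableU; apply: measurableD; exact: mp.
Qed.

Lemma disagreementC S T : disagreement S T = disagreement T S.
Proof. by apply/seteqP; split=> x /= /nesym. Qed.

Lemma disagreement_triangle (mu : probability (borel X) R) S T U :
  (mu (disagreement S U) <=
   mu (disagreement S T) + mu (disagreement T U))%E.
Proof.
apply: (@le_trans _ _ (mu (disagreement S T `|` disagreement T U))).
  apply: le_measure; rewrite ?inE; try exact: disagreement_measurable.
    by apply: measurableU; exact: disagreement_measurable.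
  move=> x /= SU; have [ST|] := pselect (S x = T x); last by left.
  by right => TU; apply: SU; rewrite ST.
by apply: measureU2; exact: disagreement_measurable.
Qed.

Lemma disagreementxx T : disagreement T T = set0.
Proof. by apply/seteqP; split=> x. Qed.

Lemma unif_nbhd_center T n (mu : 'I_n.+1 -> probability (borel X) R) (e : R) :
  (0 < e)%R -> unif_nbhd T mu e T.
Proof. by move=> e0 i; rewrite disagreementxx measure0. Qed.

Lemma unif_nbhd_recenter T S n (mu : 'I_n.+1 -> probability (borel X) R) (e : R) :
  unif_nbhd T mu e S ->
  exists2 d : R, (0 < d)%R & unif_nbhd S mu d `<=` unif_nbhd T mu e.
Proof.
move=> TS.
have fE i : mu i (disagreement S T) \is a fin_num.
  by apply: fin_num_measure; exact: disagreement_measurable.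
exists (\big[Order.min/1%R]_(i < n.+1) (e - fine (mu i (disagreement S T))))%R.
  apply: lt_bigmin => // i _.
  by rewrite subr_gt0 -lte_fin fineK.
move=> V SV i; apply: (le_lt_trans (disagreement_triangle _ _ S _)).
rewrite -[X in (_ + X)%E]fineK // -lteBrDr //.
apply: (lt_le_trans (SV i)).
by rewrite -EFinB lee_fin; exact: bigmin_le_cond.
Qed.

Lemma unif_nbhd_le T n (mu : 'I_n.+1 -> probability (borel X) R) (d e : R) :
  (d <= e)%R -> unif_nbhd T mu d `<=` unif_nbhd T mu e.
Proof. by move=> de S TS i; apply: (lt_le_trans (TS i)); rewrite lee_fin. Qed.

Definition join_mu m n (mu : 'I_m.+1 -> probability (borel X) R)
    (nu : 'I_n.+1 -> probability (borel X) R) :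
    'I_(m + n.+1).+1 -> probability (borel X) R :=
  fun i : 'I_(m.+1 + n.+1) =>
    match fintype.split i with inl j => mu j | inr k => nu k end.

Lemma unif_nbhd_join T m n (mu : 'I_m.+1 -> probability (borel X) R)
    (nu : 'I_n.+1 -> probability (borel X) R) (e : R) :
  unif_nbhd T (join_mu mu nu) e `<=` unif_nbhd T mu e `&` unif_nbhd T nu e.
Proof.
move=> S TS; split=> i.
  have := TS (lshift n.+1 i); rewrite /join_mu.
  case: fintype.splitP => j /= ij; last by have := ltn_ord i; rewrite ij ltnNge leq_addr.
  by rewrite (ord_inj ij).
have := TS (@rshift m.+1 n.+1 i); rewrite /join_mu.
case: fintype.splitP => j /= ij; first by have := ltn_ord j; rewrite -ij ltnNge leq_addr.
by move/addnI : ij => /ord_inj ->.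
Qed.

Fact unif_base_cover : \bigcup_(U in @unif_base R X) U = setT.
Proof.
apply/seteqP; split=> // T _.
pose mu := (fun=> @dirac _ (borel X) point R) : 'I_1 -> probability (borel X) R.
exists (unif_nbhd T mu 1%R); first by exists T, 0%N, mu, 1%R.
exact: unif_nbhd_center.
Qed.

Fact unif_base_join (U V : set (unifAut R X)) (T : unifAut R X) :
  unif_base U -> unif_base V -> U T -> V T ->
  exists W, [/\ unif_base W, W T & W `<=` U `&` V].
Proof.
move=> [T1 [m [mu [e [e0 ->]]]]] [T2 [n [nu [d [d0 ->]]]]].
move=> /unif_nbhd_recenter[e' e'0 sub1] /unif_nbhd_recenter[d' d'0 sub2].
have m0 : (0 < Num.min e' d')%R by rewrite lt_min e'0.
exists (unif_nbhd T (join_mu mu nu) (Num.min e' d')); split.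
- by exists T, (m + n.+1)%N, (join_mu mu nu), (Num.min e' d').
- exact: unif_nbhd_center.
- move=> S /unif_nbhd_join[S1 S2]; split.
    by apply: sub1; apply: unif_nbhd_le S1; rewrite ge_min lexx.
  by apply: sub2; apply: unif_nbhd_le S2; rewrite ge_min lexx orbT.
Qed.

HB.instance Definition _ :=
  isBaseTopological.Build (unifAut R X) unif_base_cover unif_base_join.

Lemma nbhs_unifP (T : unifAut R X) (A : set (unifAut R X)) :
  nbhs T A <-> exists n (mu : 'I_n.+1 -> probability (borel X) R) (e : R),
    (0 < e)%R /\ unif_nbhd T mu e `<=` A.
Proof.
split=> [[B [[D sD <-]] [V DV VT] sBA]|[n [mu [e [e0 sA]]]]].
  have [T' [n [mu [e [e0 eV]]]]] := sD _ DV.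
  move: VT; rewrite eV => /unif_nbhd_recenter[d d0 sub].
  exists n, mu, d; split=> // S /sub; rewrite -eV => VS.
  by apply: sBA; exists V.
exists (unif_nbhd T mu e); split=> //; last exact: unif_nbhd_center.
exists [set unif_nbhd T mu e]; last by rewrite bigcup_set1.
by move=> _ ->; exists T, n, mu, e.
Qed.

Definition push_mu (T : borelAut X) (mu : probability (borel X) R) :
    probability (borel X) R :=
  let f : {mfun borel X >-> borel X} :=
    HB.pack (T : borel X -> borel X)
      (isMeasurableFun.Build _ _ _ _ (T : borel X -> borel X) (aut_measurable T)) in
  distribution mu f.

Lemma push_muE T mu (A : set (borel X)) : push_mu T mu A = mu (T @^-1` A).
Proof. by []. Qed.

Fact unif_mul_continuous :
  continuous (fun x : unifAut R X * unifAut R X => x.1 * x.2).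
Proof.
move=> [S T] A /= /nbhs_unifP[n [mu [e [e0 sA]]]].
have e20 : (0 < e / 2)%R by rewrite divr_gt0.
exists (unif_nbhd S (fun i => push_mu T (mu i)) (e / 2)%R, unif_nbhd T mu (e / 2)%R) => /=.
  split; apply/nbhs_unifP; first by exists n, (fun i => push_mu T (mu i)), (e / 2)%R; split.
  by exists n, mu, (e / 2)%R; split.
move=> [S' T'] /= [SS' TT']; apply: sA => i.
apply: (le_lt_trans (disagreement_triangle _ _ (S' * T : borelAut X) _)).
rewrite [e]splitr EFinD; apply: lte_leD.
- by apply: fin_num_measure; exact: disagreement_measurable.
- apply: le_lt_trans (TT' i); apply: le_measure; rewrite ?inE;
    try exact: disagreement_measurable.
  by move=> x /= neq eq; apply: neq; rewrite /= eq.
- by apply/ltW; exact: (SS' i).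
Qed.

Fact unif_inv_continuous : continuous (fun x : unifAut R X => x^-1).
Proof.
move=> T A /= /nbhs_unifP[n [mu [e [e0 sA]]]].
apply/nbhs_unifP; exists n, (fun i => push_mu (autV T) (mu i)), e; split=> //.
move=> S TS; apply: sA => i; apply: le_lt_trans (TS i); rewrite push_muE.
apply: le_measure; rewrite ?inE; first exact: disagreement_measurable.
  rewrite -[X in measurable X]setTI; apply: (inv_measurable T) => //.
  exact: disagreement_measurable.
move=> x /= neq eq; apply: neq => /=.
by rewrite -[RHS](aut_funK S) eq aut_invK.
Qed.

HB.instance Definition _ := PreTopologicalGroup_isTopologicalGroup.Build
  (unifAut R X) unif_mul_continuous unif_inv_continuous.

End UniformTopology.

Definition homeo_set (R : realType) (X : cantorSetType) : set (unifAut R X) :=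
  [set T | continuous (aut_fun T) /\ continuous (aut_inv T)].

Definition unifHomeo (R : realType) (X : cantorSetType) : Type :=
  set_type (@homeo_set R X).

Section HomeoGroup.
Context {R : realType} {X : cantorSetType}.

Fact homeo_group_closed : group_closed (mem (@homeo_set R X)).
Proof.
split; first by rewrite inE; split=> x; apply: cvg_id.
move=> S T; rewrite !inE => -[cS cS'] [cT cT']; split=> x.
  by apply: continuous_comp; [exact: cT'|exact: cS].
by apply: continuous_comp; [exact: cS'|exact: cT].
Qed.

HB.instance Definition _ := SubChoice.on (unifHomeo R X).
HB.instance Definition _ := Topological.copy (unifHomeo R X)
  (initial_topology (val : unifHomeo R X -> unifAut R X)).
HB.instance Definition _ := SubChoice_isSubGroup.Build
  (unifAut R X) (mem (@homeo_set R X)) (unifHomeo R X) homeo_group_closed.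

Let val_continuous : continuous (val : unifHomeo R X -> unifAut R X).
Proof. exact: initial_continuous. Qed.

Fact homeo_mul_continuous :
  continuous (fun x : unifHomeo R X * unifHomeo R X => x.1 * x.2).
Proof.
apply: (@continuous_comp_initial _ _ _ (val : unifHomeo R X -> unifAut R X)) => -[S T].
apply: (@continuous_comp _ _ _
  (fun x : unifHomeo R X * unifHomeo R X => (val x.1, val x.2))
  (fun y : unifAut R X * unifAut R X => y.1 * y.2)); last exact: mulg_continuous.
apply: (@cvg_pair _ _ _ (nbhs (S, T)) (nbhs (val S)) (nbhs (val T)) _ _ _
  (fun x : unifHomeo R X * unifHomeo R X => val x.1) (fun x => val x.2)) => /=.
- move=> A /val_continuous hA; exact: (@cvg_fst _ _ (nbhs S) (nbhs T) _ _ hA).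
- move=> A /val_continuous hA; exact: (@cvg_snd _ _ (nbhs S) (nbhs T) _ _ hA).
Qed.

Fact homeo_inv_continuous : continuous (fun x : unifHomeo R X => x^-1).
Proof.
apply: (@continuous_comp_initial _ _ _ (val : unifHomeo R X -> unifAut R X)) => T.
move=> A /(@invg_continuous (unifAut R X) (val T)) hA.
exact: (val_continuous hA).
Qed.

HB.instance Definition _ := PreTopologicalGroup_isTopologicalGroup.Build
  (unifHomeo R X) homeo_mul_continuous homeo_inv_continuous.

End HomeoGroup.

(* Main.v *)
From HB Require Import structures.
Require Import Defs.
From mathcomp Require Import all_boot all_order all_algebra.
From mathcomp Require Import all_classical all_reals all_analysis.
From mathcomp Require Import zify lra.

(** One homeomorphism serves for both groups. On the space of binary sequences
    the map [model] permutes cyclically, for every [e], the [e.+1] cylinders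
    [1^e 0 1^i 0] with [i <= e]; it has cycles of cylinders of every period. Its
    conjugates approximate any automorphism [T] for the following reasons.

    Fix a finite measure and [N]. Looking at orbits through the first [n]
    coordinates only, a greedy choice gives a set of markers which every orbit
    of [T] meets in every time interval of length [2 N]. Outside a small set, if
    [n] is large, the markers on a periodic orbit of period less than [N] form a
    single point ([marker_return]), while on the other orbits they are at
    distance at least [N] ([marker_disjoint]). On the orbits of the second kind
    [N] translates of the markers are disjoint, so for some translate [E] the
    part of [E] on these orbits has small measure when [N] is large.

    Cut the orbits at [E]. They become chains of bounded length, and closing
    each chain into a cycle gives a map of finite order which differs from [T]
    only on a small set: nothing changes on the periodic orbits that are cut at
    a single point. The chains with [e.+1] points can be coded inside the
    cylinder [1^e 0] so that [model] becomes this map ([castle_conjugate]). To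
    obtain a bijection of the whole space, the chains that meet some cylinder
    are left out, and their union is matched with the set of unused codes. The
    cylinder is chosen so that this union has small measure. The matching
    exists because both sets contain a cylinder: by an absorption argument in
    the manner of Pelczynski, such a set is isomorphic to the whole space
    ([alg_iso_full]).

    Each step stays within an algebra of sets, which may consist of the clopen
    sets or of the Borel sets. The clopen sets give the statement on
    homeomorphisms, the Borel sets the one on Borel automorphisms. *)

Set Implicit Arguments.
Unset Strict Implicit.
Unset Printing Implicit Defensive.

Import Order.TTheory GRing.Theory Num.Theory.

Local Open Scope classical_set_scope.

(** * Algebras of predicates on binary sequences *)

Notation bseq := (nat -> bool).

(** An algebra of predicates on binary sequences, given with the maps it
    preserves: the clopen predicates with the continuous maps, and the Borel
    predicates with the Borel maps. The last axiom says that a map belongs to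
    this class as soon as its coordinates do. *)
Record coordinate_algebra (A : (bseq -> bool) -> Prop) : Prop := {
  alg_coord : forall n, A (fun x => x n) ;
  alg_neg : forall P, A P -> A (fun x => ~~ P x) ;
  alg_and : forall P Q, A P -> A Q -> A (fun x => P x && Q x) ;
  alg_comp : forall P f, A P -> (forall n, A (fun x => f x n)) ->
    A (fun x => P (f x))
}.

(** A map all of whose coordinates belong to [A]. *)
Definition alg_map (A : (bseq -> bool) -> Prop) (f : bseq -> bseq) :=
  forall n, A (fun x => f x n).

Definition shift (k : nat) (x : bseq) : bseq := fun n => x (k + n).

Definition bcons (b : bool) (x : bseq) : bseq :=
  fun n => if n is n'.+1 then x n' else b.

(** The list of the first [n] terms. *)
Definition prefix (n : nat) (x : bseq) : seq bool := mkseq x n.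

Section AlgebraTheory.
Context {A : (bseq -> bool) -> Prop} (hA : coordinate_algebra A).
Implicit Types (P Q : bseq -> bool) (f g : bseq -> bseq) (u : bseq -> nat).

Lemma alg_eq P Q : P =1 Q -> A P -> A Q.
Proof. by move=> /funext ->. Qed.

Lemma alg_or P Q : A P -> A Q -> A (fun x => P x || Q x).
Proof.
move=> aP aQ; apply: (@alg_eq (fun x => ~~ (~~ P x && ~~ Q x))).
  by move=> x; rewrite negb_and !negbK.
by apply: alg_neg => //; apply: alg_and => //; exact: alg_neg.
Qed.

Lemma alg_const (b : bool) : A (fun=> b).
Proof.
have aT : A (fun=> true).
  apply: (@alg_eq (fun x => x 0 || ~~ x 0)); first by move=> x; rewrite orbN.
  by apply: alg_or; [|apply: alg_neg => //]; exact: alg_coord.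
by case: b => //; exact: (alg_neg hA aT).
Qed.

Lemma alg_if P Q1 Q2 : A P -> A Q1 -> A Q2 ->
  A (fun x => if P x then Q1 x else Q2 x).
Proof.
move=> aP a1 a2.
apply: (@alg_eq (fun x => (P x && Q1 x) || (~~ P x && Q2 x))).
  by move=> x; case: (P x); rewrite ?orbF.
by apply: alg_or; apply: alg_and => //; exact: alg_neg.
Qed.

Lemma alg_eqb P Q : A P -> A Q -> A (fun x => P x == Q x).
Proof.
move=> aP aQ; apply: (@alg_eq (fun x => if P x then Q x else ~~ Q x)).
  by move=> x; case: (P x); case: (Q x).
by apply: alg_if => //; exact: alg_neg.
Qed.

Lemma alg_has (T : Type) (s : seq T) (P : T -> bseq -> bool) :
  (forall i, A (P i)) -> A (fun x => has (fun i => P i x) s).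
Proof.
move=> aP; elim: s => [|i s IHs] /=; first exact: alg_const.
by apply: alg_or.
Qed.

Lemma alg_all (T : Type) (s : seq T) (P : T -> bseq -> bool) :
  (forall i, A (P i)) -> A (fun x => all (fun i => P i x) s).
Proof.
move=> aP; elim: s => [|i s IHs] /=; first exact: alg_const.
by apply: alg_and.
Qed.

Lemma alg_map_comp f g :
  alg_map A f -> alg_map A g -> alg_map A (fun x => f (g x)).
Proof. by move=> af ag n; apply: (alg_comp hA (af n)). Qed.

Lemma alg_map_iter f k : alg_map A f -> alg_map A (fun x => iter k f x).
Proof.
move=> af; elim: k => [|k IHk] /=; first by move=> n; exact: alg_coord.
exact: alg_map_comp.
Qed.

Lemma alg_map_if P f g : A P -> alg_map A f -> alg_map A g ->
  alg_map A (fun x => if P x then f x else g x).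
Proof.
move=> aP af ag n; apply: (@alg_eq (fun x => if P x then f x n else g x n)).
  by move=> x; case: (P x).
exact: alg_if.
Qed.

Lemma alg_map_shift k : alg_map A (shift k).
Proof. by move=> n; exact: (alg_coord hA). Qed.

Lemma alg_map_bcons b : alg_map A (bcons b).
Proof. by case=> [|n] /=; [exact: alg_const|exact: (alg_coord hA)]. Qed.

Lemma alg_prefix_eq n f g : alg_map A f -> alg_map A g ->
  A (fun x => prefix n (f x) == prefix n (g x)).
Proof.
move=> af ag.
apply: (@alg_eq (fun x => all (fun i => f x i == g x i) (iota 0 n))).
  move=> x; apply/allP/eqP => [h|h i].
    by apply/eq_in_map => i /h /eqP.
  by move/eq_in_map: h => h im; rewrite h.
by apply: alg_all => i; exact: alg_eqb.
Qed.

Lemma alg_prefix_const n f w : alg_map A f -> A (fun x => prefix n (f x) == w).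
Proof.
move=> af.
apply: (@alg_eq (fun x => (n == size w) &&
    all (fun i => f x i == nth false w i) (iota 0 n))).
  move=> x; apply/andP/eqP => [[/eqP nw /allP h]|<-].
    apply: (@eq_from_nth _ false); rewrite size_mkseq // => i im.
    by rewrite nth_mkseq //; apply/eqP/h; rewrite mem_iota.
  rewrite size_mkseq; split => //; apply/allP => i; rewrite mem_iota => im.
  by rewrite nth_mkseq.
apply: alg_and => //; first exact: alg_const.
by apply: alg_all => i; apply: alg_eqb => //; exact: alg_const.
Qed.

(** A map given by finitely many maps of the class, chosen by a bounded index
    whose level sets lie in the algebra. *)
Lemma alg_map_cases L u (F : nat -> bseq -> bseq) :
  (forall x, u x <= L) -> (forall k, A (fun x => u x == k)) ->
  (forall k, alg_map A (F k)) -> alg_map A (fun x => F (u x) x).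
Proof.
move=> uL au aF n.
apply: (@alg_eq (fun x => has (fun k => (u x == k) && F k x n) (iota 0 L.+1))).
  move=> x; apply/hasP/idP => [|h]; first by case=> k _ /andP[/eqP ->].
  by exists (u x); [rewrite mem_iota ltnS uL|rewrite eqxx].
by apply: alg_has => k; apply: alg_and => //; exact: aF.
Qed.

Lemma alg_cases L u (F : nat -> bseq -> bool) :
  (forall x, u x <= L) -> (forall k, A (fun x => u x == k)) ->
  (forall k, A (F k)) -> A (fun x => F (u x) x).
Proof.
move=> uL au aF.
apply: (@alg_eq (fun x => has (fun k => (u x == k) && F k x) (iota 0 L.+1))).
  move=> x; apply/hasP/idP => [|h]; first by case=> k _ /andP[/eqP ->].
  by exists (u x); [rewrite mem_iota ltnS uL|rewrite eqxx].
by apply: alg_has => k; apply: alg_and => //; exact: aF.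
Qed.

Lemma alg_find (P : nat -> bseq -> bool) s k :
  (forall i, A (P i)) -> A (fun x => find (fun i => P i x) s == k).
Proof.
move=> aP; elim: s k => [|i s IHs] k /=; first exact: alg_const.
apply: (@alg_eq (fun x => if P i x then 0 == k else
    (0 < k) && (find (fun i => P i x) s == k.-1))).
  by move=> x; case: (P i x) => //; case: k.
apply: alg_if => //; first exact: alg_const.
by apply: alg_and => //; exact: alg_const.
Qed.

End AlgebraTheory.

Lemma bcons_shift x : bcons (x 0) (shift 1 x) = x.
Proof. by apply/funext => -[|n]. Qed.

Lemma shift_bcons k b x : shift k.+1 (bcons b x) = shift k x.
Proof. by apply/funext. Qed.

Lemma shift0 x : shift 0 x = x.
Proof. by apply/funext. Qed.

(** The sequence [1^m 0 x]. *)
Definition ones (m : nat) (x : bseq) : bseq := iter m (bcons true) (bcons false x).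

(** The number of leading ones of [x], truncated at [L]. *)
Definition lead (L : nat) (x : bseq) : nat := find (fun i => ~~ x i) (iota 0 L).

Lemma lead_le L x : lead L x <= L.
Proof. by rewrite /lead -[leqRHS](size_iota 0) find_size. Qed.

Lemma lead_bcons_true L x : lead L.+1 (bcons true x) = (lead L x).+1.
Proof.
by rewrite /lead /= (iotaDl 1 0) find_map.
Qed.

Lemma lead_ones L m x : m < L -> lead L (ones m x) = m.
Proof.
elim: m L => [|m IHm] [|L] // mL.
by rewrite /ones iterS lead_bcons_true IHm.
Qed.

Lemma shift_ones m x : shift m.+1 (ones m x) = x.
Proof.
elim: m => [|m IHm]; first by apply/funext.
by rewrite /ones iterS shift_bcons.
Qed.

Lemma ones_lead L x : lead L x < L -> ones (lead L x) (shift (lead L x).+1 x) = x.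
Proof.
elim: L x => [|L IHL] x //; rewrite -[x]bcons_shift.
case: (x 0); last by move=> _; rewrite /lead /= shift_bcons shift0.
rewrite lead_bcons_true ltnS shift_bcons => /IHL h.
by rewrite /ones iterS -/(ones _ _) h.
Qed.

(** * Absorbing a set into a cylinder *)

(** The sets [1^n 0 P] are disjoint copies of [P]; [absorb P] moves each of them
    to the next one and fixes every other point, so its image is the complement
    of [0 P]. The coordinates are defined by recursion along the leading ones;
    this is what makes [absorb P] continuous at [1^oo] when [P] is clopen. *)
Fixpoint absorb_coord (P : bseq -> bool) (n : nat) (x : bseq) : bool :=
  if n is n'.+1 then
    if x 0 then absorb_coord P n' (shift 1 x)
    else if P (shift 1 x) then x n' else x n
  else x 0 || P (shift 1 x).

Definition absorb P x : bseq := fun n => absorb_coord P n x.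

(** The inverse of [absorb P], defined everywhere but meaningful only outside
    [0 P]. *)
Fixpoint unabsorb_coord (P : bseq -> bool) (n : nat) (x : bseq) : bool :=
  if x 0 then
    if x 1 then if n is n'.+1 then unabsorb_coord P n' (shift 1 x) else true
    else if P (shift 2 x) then x n.+1 else x n
  else x n.

Definition unabsorb P x : bseq := fun n => unabsorb_coord P n x.

Arguments absorb P x n : simpl never.
Arguments unabsorb P x n : simpl never.

Lemma absorb_true P x : absorb P (bcons true x) = bcons true (absorb P x).
Proof. by apply/funext => -[|n]. Qed.

Lemma absorb_false P x : absorb P (bcons false x) =
  if P x then bcons true (bcons false x) else bcons false x.
Proof.
by apply/funext => -[|n]; rewrite /absorb /= shift_bcons shift0;
  case: (P x) => //; case: n.
Qed.

Lemma unabsorb_false P x : unabsorb P (bcons false x) = bcons false x.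
Proof. by apply/funext => -[|n]. Qed.

Lemma unabsorb_true_false P x : unabsorb P (bcons true (bcons false x)) =
  if P x then bcons false x else bcons true (bcons false x).
Proof.
by apply/funext => -[|n]; rewrite /unabsorb /= !shift_bcons shift0; case: (P x).
Qed.

Lemma unabsorb_true_true P x : unabsorb P (bcons true (bcons true x)) =
  bcons true (unabsorb P (bcons true x)).
Proof. by apply/funext => -[|n]. Qed.

Lemma absorb_notin P (x : bseq) :
  absorb P x 0 = false -> P (shift 1 (absorb P x)) = false.
Proof.
rewrite -[x]bcons_shift; case: (x 0); first by rewrite absorb_true.
by rewrite absorb_false; case: ifP.
Qed.

Lemma absorbK P x : unabsorb P (absorb P x) = x.
Proof.
apply/funext => n; elim: n x => [|n IHn] x; rewrite -[x]bcons_shift;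
  case x0: (x 0); rewrite ?absorb_true ?absorb_false.
- have := absorb_notin (P := P) (x := shift 1 x).
  rewrite -[absorb P _]bcons_shift; case: (absorb P _ 0).
    by rewrite unabsorb_true_true.
  by rewrite unabsorb_true_false shift_bcons shift0 => ->.
- by case: ifP => Px; rewrite ?unabsorb_true_false ?Px ?unabsorb_false.
- have := absorb_notin (P := P) (x := shift 1 x).
  rewrite -[absorb P _]bcons_shift; case e: (absorb P _ 0).
    by rewrite unabsorb_true_true /= => _; rewrite -{1}e bcons_shift IHn.
  rewrite unabsorb_true_false shift_bcons shift0 => -> //.
  have := IHn (shift 1 x).
  by rewrite -{1}[absorb P (shift 1 x)]bcons_shift e unabsorb_false.
- by case: ifP => Px; rewrite ?unabsorb_true_false ?Px ?unabsorb_false.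
Qed.

Lemma unabsorbK P (y : bseq) :
  ~~ (~~ y 0 && P (shift 1 y)) -> absorb P (unabsorb P y) = y.
Proof.
move=> yP; apply/funext => n; elim: n y yP => [|n IHn] y yP;
  rewrite -[y]bcons_shift; move: yP; case y0: (y 0) => //= yP; last 2 first.
- rewrite -[shift 1 y]bcons_shift; case y1: (shift 1 y 0).
    rewrite unabsorb_true_true. rewrite absorb_true /= -{1}y1 bcons_shift.
    have -> : bcons true (shift 1 (shift 1 y)) = shift 1 y.
      by rewrite -{1}y1 bcons_shift.
    by rewrite IHn ?y1.
  rewrite unabsorb_true_false; case: ifP => Py;
    by rewrite ?absorb_true absorb_false Py.
- by rewrite unabsorb_false absorb_false (negbTE yP).
- rewrite -[shift 1 y]bcons_shift; case y1: (shift 1 y 0).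
    by rewrite unabsorb_true_true absorb_true.
  rewrite unabsorb_true_false; case: ifP => Py;
    by rewrite ?absorb_true absorb_false Py.
- by rewrite unabsorb_false absorb_false (negbTE yP).
Qed.

Section AbsorbAlgebra.
Context {A : (bseq -> bool) -> Prop} (hA : coordinate_algebra A).

Lemma alg_lead L k : A (fun x => lead L x == k).
Proof. by apply: (alg_find hA) => i; apply: (alg_neg hA); exact: (alg_coord hA). Qed.

Lemma alg_map_ones m : alg_map A (ones m).
Proof.
apply: (alg_map_comp hA (alg_map_iter hA m _) (alg_map_bcons hA false)).
exact: alg_map_bcons.
Qed.

Lemma alg_map_absorb P : A P -> alg_map A (absorb P).
Proof.
move=> aP n; rewrite /absorb; elim: n => [|n IHn] /=.
  apply: (alg_or hA); first exact: (alg_coord hA).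
  by apply: (alg_comp hA aP) => n; exact: (alg_map_shift hA).
apply: (alg_if hA); first exact: (alg_coord hA).
  by apply: (alg_comp hA IHn) => k; exact: (alg_map_shift hA).
apply: (alg_if hA); [|exact: (alg_coord hA)..].
by apply: (alg_comp hA aP) => k; exact: (alg_map_shift hA).
Qed.

Lemma alg_map_unabsorb P : A P -> alg_map A (unabsorb P).
Proof.
move=> aP n; rewrite /unabsorb.
have aP2 : A (fun x => P (shift 2 x)).
  by apply: (alg_comp hA aP) => k; exact: (alg_map_shift hA).
elim: n => [|n IHn] /=; do 2?[apply: (alg_if hA); first exact: (alg_coord hA)];
  rewrite ?/unabsorb_coord; try exact: (alg_coord hA).
- exact: (alg_const hA).
- by apply: (alg_if hA) => //; exact: (alg_coord hA).
- by apply: (alg_comp hA IHn) => k; exact: (alg_map_shift hA).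
- by apply: (alg_if hA) => //; exact: (alg_coord hA).
Qed.

(** Two sets of the algebra are isomorphic to the whole space, hence to each
    other, as soon as they contain a cylinder: [P] splits into the cylinder
    [1^m 0] and a rest, and the rest is absorbed. *)
Lemma alg_iso_full P m : A P -> (forall y, P (ones m y)) ->
  exists f f' : bseq -> bseq,
    [/\ alg_map A f, alg_map A f', cancel f f', forall y, P (f y) &
        forall x, P x -> f (f' x) = x].
Proof.
move=> aP Pm; pose K x := lead m.+1 x == m.
pose Q x := P x && ~~ K x.
have Kones y : K (ones m y) by rewrite /K lead_ones.
have aK : A K by exact: alg_lead.
have aQ : A Q by apply: (alg_and hA) => //; exact: (alg_neg hA).
have onesK x : K x -> ones m (shift m.+1 x) = x.
  by move=> /eqP Kx; have := @ones_lead m.+1 x; rewrite Kx; apply.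
exists (fun y => if ~~ y 0 && Q (shift 1 y) then shift 1 y
                 else ones m (unabsorb Q y)).
exists (fun x => if K x then absorb Q (shift m.+1 x) else bcons false x).
split.
- apply: (alg_map_if hA).
  + apply: (alg_and hA); first by apply: (alg_neg hA); exact: (alg_coord hA).
    by apply: (alg_comp hA aQ) => k; exact: (alg_map_shift hA).
  + exact: (alg_map_shift hA).
  + by apply: (alg_map_comp hA); [exact: alg_map_ones|exact: alg_map_unabsorb].
- apply: (alg_map_if hA) => //; last exact: (alg_map_bcons hA).
  apply: (alg_map_comp hA); first exact: alg_map_absorb.
  exact: (alg_map_shift hA).
- move=> y; case: (boolP (_ && _)) => [/andP[y0 /andP[_ /negbTE ->]]|yQ].
    by rewrite -[RHS]bcons_shift (negbTE y0).
  by rewrite Kones shift_ones unabsorbK.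
- by move=> y; case: ifPn => // /andP[_ /andP[]].
- move=> x Px; case: (boolP (K x)) => [Kx|nKx] /=; last first.
    by rewrite shift_bcons shift0 /Q Px nKx.
  case: ifPn => [/andP[/negbTE /absorb_notin ->] //|_].
  by rewrite absorbK onesK.
Qed.

(** * The model automorphism *)

(** [fan f a] maps [1^e 0 y] to [1^e 0 (f (a + e) y)], and fixes [1^oo]. *)
Fixpoint fan_coord (f : nat -> bseq -> bseq) (e n : nat) (x : bseq) : bool :=
  if n is n'.+1 then
    if x 0 then fan_coord f e.+1 n' (shift 1 x) else f e (shift 1 x) n'
  else x 0.

Definition fan f e x : bseq := fun n => fan_coord f e n x.
Arguments fan f e x n : simpl never.

Lemma fan_true f e x : fan f e (bcons true x) = bcons true (fan f e.+1 x).
Proof. by apply/funext => -[|n]. Qed.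

Lemma fan_false f e x : fan f e (bcons false x) = bcons false (f e x).
Proof. by apply/funext => -[|n]. Qed.

Lemma fan_ones f a e x : fan f a (ones e x) = ones e (f (a + e) x).
Proof.
elim: e a => [|e IHe] a; first by rewrite addn0; exact: fan_false.
by rewrite /ones !iterS fan_true -/(ones e x) IHe addSnnS.
Qed.

Lemma fanK f f' : (forall e, cancel (f e) (f' e)) ->
  forall e, cancel (fan f e) (fan f' e).
Proof.
move=> fK e x; apply/funext => n; elim: n e x => [|n IHn] e x;
  rewrite -[x]bcons_shift; case: (x 0);
  rewrite ?fan_true ?fan_true ?fan_false ?fan_false ?fK //.
exact: IHn.
Qed.

Lemma alg_map_fan f : (forall e, alg_map A (f e)) ->
  forall e, alg_map A (fan f e).
Proof.
move=> af e n; rewrite /fan; elim: n e => [|n IHn] e /=; first exact: (alg_coord hA).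
apply: (alg_if hA); first exact: (alg_coord hA).
  by apply: (alg_comp hA (IHn _)) => k; exact: (alg_map_shift hA).
by apply: (alg_comp hA (af e n)) => k; exact: (alg_map_shift hA).
Qed.

(** [cycle_ones e] permutes cyclically the [e.+1] cylinders [1^i 0], [i <= e],
    by a change of prefix; the other points are fixed. *)
Definition cycle_ones (e : nat) (y : bseq) : bseq :=
  if lead e.+1 y == e.+1 then y
  else if lead e.+1 y == e then shift e y else bcons true y.

Definition uncycle_ones (e : nat) (y : bseq) : bseq :=
  if lead e.+1 y == e.+1 then y
  else if y 0 then shift 1 y else iter e (bcons true) y.

Lemma shift_ones_le e x : shift e (ones e x) = ones 0 x.
Proof.
elim: e => [|e IHe]; first exact: shift0.
by rewrite /ones iterS shift_bcons.
Qed.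

Lemma cycle_ones_lt e i x : i < e -> cycle_ones e (ones i x) = ones i.+1 x.
Proof.
move=> ie; rewrite /cycle_ones lead_ones; last exact: ltnW.
by rewrite (ltn_eqF ie) ltn_eqF // ltnW.
Qed.

Lemma cycle_ones_last e x : cycle_ones e (ones e x) = ones 0 x.
Proof. by rewrite /cycle_ones lead_ones// ltn_eqF// eqxx shift_ones_le. Qed.

Lemma uncycle_ones0 e x : uncycle_ones e (ones 0 x) = ones e x.
Proof. by rewrite /uncycle_ones lead_ones. Qed.

Lemma uncycle_onesS e i x : i < e -> uncycle_ones e (ones i.+1 x) = ones i x.
Proof.
by move=> ie; rewrite /uncycle_ones lead_ones// ltn_eqF.
Qed.

Lemma lead_case L x : lead L x = L \/ exists2 i, i < L & exists y, x = ones i y.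
Proof.
have := lead_le L x; rewrite leq_eqVlt => /orP[/eqP|]; first by left.
move=> lL; right; exists (lead L x) => //.
by exists (shift (lead L x).+1 x); rewrite ones_lead.
Qed.

Lemma cycle_onesK e : cancel (cycle_ones e) (uncycle_ones e).
Proof.
move=> x; case: (lead_case e.+1 x) => [xe|[i ie [y ->]]].
  by rewrite /cycle_ones xe eqxx /uncycle_ones xe eqxx.
move: ie; rewrite ltnS leq_eqVlt => /orP[/eqP ->|ie].
  by rewrite cycle_ones_last uncycle_ones0.
by rewrite cycle_ones_lt// uncycle_onesS.
Qed.

Lemma uncycle_onesK e : cancel (uncycle_ones e) (cycle_ones e).
Proof.
move=> x; case: (lead_case e.+1 x) => [xe|[[|i] ie [y ->]]].
- by rewrite /uncycle_ones xe eqxx /cycle_ones xe eqxx.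
- by rewrite uncycle_ones0 cycle_ones_last.
- by rewrite uncycle_onesS// cycle_ones_lt.
Qed.

Lemma alg_map_cycle_ones e : alg_map A (cycle_ones e).
Proof.
have al k : A (fun x => lead e.+1 x == k) by exact: alg_lead.
apply: (alg_map_if hA) => //; first by move=> n; exact: (alg_coord hA).
apply: (alg_map_if hA) => //; first exact: (alg_map_shift hA).
exact: (alg_map_bcons hA).
Qed.

Lemma alg_map_uncycle_ones e : alg_map A (uncycle_ones e).
Proof.
apply: (alg_map_if hA); [exact: alg_lead|by move=> n; exact: (alg_coord hA)|].
apply: (alg_map_if hA); [exact: (alg_coord hA)|exact: (alg_map_shift hA)|].
by apply: (alg_map_iter hA); exact: (alg_map_bcons hA).
Qed.

End AbsorbAlgebra.

(** The model automorphism: on the cylinder [1^e 0] it permutes cyclically the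
    cylinders [1^e 0 1^i 0] with [i <= e]. So every positive period occurs, on a
    cycle of cylinders. *)
Definition model : bseq -> bseq := fan cycle_ones 0.
Definition model_inv : bseq -> bseq := fan uncycle_ones 0.

Lemma modelK : cancel model model_inv.
Proof. by apply: fanK; exact: cycle_onesK. Qed.

Lemma model_invK : cancel model_inv model.
Proof. by apply: fanK; exact: uncycle_onesK. Qed.

Lemma model_lt e i x : i < e -> model (ones e (ones i x)) = ones e (ones i.+1 x).
Proof. by move=> ie; rewrite /model fan_ones add0n cycle_ones_lt. Qed.

Lemma model_last e x : model (ones e (ones e x)) = ones e (ones 0 x).
Proof. by rewrite /model fan_ones add0n cycle_ones_last. Qed.

(** * Conjugating the model to a castle *)

Lemma iter_cancel_le (X : Type) (f f' : X -> X) i k x :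
  cancel f f' -> i <= k -> iter i f' (iter k f x) = iter (k - i) f x.
Proof.
move=> fK; elim: i k => [|i IHi] k ik; first by rewrite subn0.
by rewrite iterSr; case: k ik => // k ik /=; rewrite fK IHi.
Qed.

Lemma find_iotaP (P : pred nat) L i : i < L -> P i ->
  let k := find P (iota 0 L) in
  [/\ k < L, P k & forall j, j < k -> ~~ P j].
Proof.
move=> iL Pi k.
have hP : has P (iota 0 L) by apply/hasP; exists i; rewrite // mem_iota.
have kL : k < L by rewrite -[ltnRHS](size_iota 0) -has_find.
split=> //; first by have := nth_find 0 hP; rewrite nth_iota.
move=> j jk; have := before_find 0 jk.
by rewrite nth_iota ?(ltn_trans jk)//= => ->.
Qed.

Lemma find_iota_eq (P : pred nat) L i : i < L -> P i ->
  (forall j, j < i -> ~~ P j) -> find P (iota 0 L) = i.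
Proof.
move=> iL Pi iP; have [kL Pk kP] := find_iotaP iL Pi.
apply/eqP; rewrite eqn_leq; apply/andP; split; rewrite leqNgt; apply/negP.
  by move=> /kP; rewrite Pi.
by move=> /iP; rewrite Pk.
Qed.

Section Castle.
Context {A : (bseq -> bool) -> Prop} (hA : coordinate_algebra A).
Context (T T' : bseq -> bseq) (aT : alg_map A T) (aT' : alg_map A T').
Context (TK : cancel T T') (T'K : cancel T' T).
Context (E : bseq -> bool) (aE : A E) (L : nat).
Context (hitE : forall x, exists2 i, i < L & E (iter i T x)).
Context (m : nat).

(** The time to the next visit of [E]. *)
Let e (b : bseq) : nat := find (fun i => E (iter i T b)) (iota 0 L).

(** The subset [E] cuts the orbits of [T] into chains: a chain ends at a point
    of [E], and the next one begins. The point [x] is at position [j x] in its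
    chain, counted from [0]. *)
Let j (x : bseq) : nat := find (fun i => E (iter i.+1 T' x)) (iota 0 L).

Let K (x : bseq) : bool := lead m.+1 x == m.

(** For the first point [b] of a chain: the chain meets the cylinder [1^m 0]. *)
Let D0 (b : bseq) : bool :=
  has (fun i => (i <= e b) && K (iter i T b)) (iota 0 L).

Let D (x : bseq) : bool := D0 (iter (j x) T' x).

(** The first points of the chains. *)
Let base (b : bseq) : bool := E (T' b).

(** The sequence [1^k 0 y] is a code, that is, [1^k 0 1^i 0 b] with [i <= k], of
    the point at position [i] in a chain of [k.+1] points which begins at [b] and
    avoids the cylinder [1^m 0]. *)
Let Q1 (k : nat) (y : bseq) : bool :=
  let b := shift (lead L y).+1 y in
  [&& k < L, lead L y <= k, base b, e b == k & ~~ D0 b].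

Let Q (y : bseq) : bool := Q1 (lead L y) (shift (lead L y).+1 y).

Let eP b : [/\ e b < L, E (iter (e b) T b) &
  forall i, i < e b -> ~~ E (iter i T b)].
Proof. by have [i iL Ei] := hitE b; exact: (find_iotaP iL Ei). Qed.

Let jP x : [/\ j x < L, E (iter (j x).+1 T' x) &
  forall i, i < j x -> ~~ E (iter i.+1 T' x)].
Proof.
have [i iL Ei] := hitE (iter L T' x).
apply: (@find_iotaP (fun i => E (iter i.+1 T' x)) L (L - i.+1)); first by lia.
by rewrite -subSn// subSS -(iter_cancel_le _ T'K) // ltnW.
Qed.

Let base_j x : base (iter (j x) T' x).
Proof. by have [] := jP x. Qed.

Let j_iter b i : base b -> i <= e b -> j (iter i T b) = i.
Proof.
move=> bb ie; have [eL _ ePm] := eP b.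
apply: find_iota_eq; first exact: leq_ltn_trans eL.
  by rewrite iterS (iter_cancel_le _ TK)// subnn.
move=> k ki; rewrite (iter_cancel_le _ TK) //; apply: ePm.
by lia.
Qed.

Let j_le_e x : j x <= e (iter (j x) T' x).
Proof.
have [_ Ee _] := eP (iter (j x) T' x); have [_ _ jPm] := jP x.
rewrite leqNgt; apply/negP => ej; move: Ee.
rewrite (iter_cancel_le _ T'K) ?(ltnW ej)//; apply/negP.
have -> : j x - e (iter (j x) T' x) = (j x - (e (iter (j x) T' x)).+1).+1 by lia.
by apply: jPm; lia.
Qed.

Let iterTK i x : iter i T (iter i T' x) = x.
Proof. by rewrite (iter_cancel_le _ T'K)// subnn. Qed.

Let iterT'K i x : iter i T' (iter i T x) = x.
Proof. by rewrite (iter_cancel_le _ TK)// subnn. Qed.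

Let K_D x : K x -> D x.
Proof.
move=> Kx; apply/hasP; exists (j x); last by rewrite j_le_e iterTK.
by have [jL _ _] := jP x; rewrite mem_iota.
Qed.

Let D_window x : D x -> exists2 a, a <= L.*2 & K (iter a T (iter L T' x)).
Proof.
move=> /hasP[i]; rewrite mem_iota => /andP[_ iL] /andP[ie Ki].
have [jL _ _] := jP x.
exists (i + (L - j x)); first by lia.
rewrite iterD (_ : iter (L - j x) T (iter L T' x) = iter (j x) T' x) //.
by rewrite (iter_cancel_le _ T'K) ?leq_subr// subKn // ltnW.
Qed.

Let D_iter b i : base b -> i <= e b -> D (iter i T b) = D0 b.
Proof. by move=> bb ie; rewrite /D j_iter// iterT'K. Qed.

Let aj k : A (fun x => j x == k).
Proof.
apply: (alg_find hA) => i; apply: (alg_comp hA aE).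
by apply: (alg_map_iter hA); exact: aT'.
Qed.

Let ae k : A (fun x => e x == k).
Proof.
apply: (alg_find hA) => i; apply: (alg_comp hA aE).
by apply: (alg_map_iter hA); exact: aT.
Qed.

Let e_le x : e x <= L. Proof. by have [/ltnW] := eP x. Qed.
Let j_le x : j x <= L. Proof. by have [/ltnW] := jP x. Qed.

Let aK : A K. Proof. exact: (alg_lead hA). Qed.

Let aD0 : A D0.
Proof.
apply: (alg_has hA) => i; apply: (alg_and hA).
  apply: (@alg_cases A hA L e (fun k _ => i <= k)) => // k.
  exact: (alg_const hA).
by apply: (alg_comp hA aK); apply: (alg_map_iter hA); exact: aT.
Qed.

Let aD : A D.
Proof.
apply: (@alg_cases A hA L j (fun k x => D0 (iter k T' x))) => // k.
by apply: (alg_comp hA aD0); apply: (alg_map_iter hA); exact: aT'.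
Qed.

Let aQ : A Q.
Proof.
apply: (@alg_cases A hA L (lead L) (fun k y => Q1 k (shift k.+1 y))).
- exact: lead_le.
- by move=> k; exact: (alg_lead hA).
move=> k; apply: (@alg_comp A hA (Q1 k)); last exact: (alg_map_shift hA).
apply: (@alg_cases A hA L (lead L) (fun i y => let b := shift i.+1 y in
  [&& k < L, i <= k, base b, e b == k & ~~ D0 b])).
- exact: lead_le.
- by move=> i; exact: (alg_lead hA).
move=> i; apply: (@alg_comp A hA
  (fun b => [&& k < L, i <= k, base b, e b == k & ~~ D0 b]));
  last exact: (alg_map_shift hA).
apply: (alg_and hA); first exact: (alg_const hA).
apply: (alg_and hA); first exact: (alg_const hA).
apply: (alg_and hA); first exact: (alg_comp hA aE).
by apply: (alg_and hA) => //; exact: (alg_neg hA).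
Qed.

Let Q_enc b i : base b -> i <= e b -> ~~ D0 b -> Q (ones (e b) (ones i b)).
Proof.
move=> bb ie nD; have [eL _ _] := eP b.
rewrite /Q lead_ones// shift_ones /Q1 lead_ones ?(leq_ltn_trans ie)//.
by rewrite shift_ones eL ie bb eqxx.
Qed.

(** A chain with [e.+1] points which avoids the cylinder [1^m 0] is carried by
    [h'] into the cylinder [1^e 0], where [model] moves along the chain and
    returns from its last point to the first one. Both the union of the other
    chains and the set of unused codes contain a cylinder, so they can be matched
    by [alg_iso_full]. Then [h model h'] agrees with [T] on the remaining chains,
    except perhaps at the last point of a chain. There it does agree if the
    previous visit of the orbit to [E] took place at the same point. *)
Lemma castle_conjugate : exists h h' : bseq -> bseq,
  [/\ alg_map A h, alg_map A h', cancel h h', cancel h' h &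
    forall x,
      (forall a, a <= L.*2 -> lead m.+1 (iter a T (iter L T' x)) != m) ->
      (E x -> forall r, E (iter r.+1 T' x) -> iter r.+1 T' x = x) ->
      h (model (h' x)) = T x].
Proof.
have [f [f' [af af' fK fD f'K]]] : exists f f' : bseq -> bseq,
    [/\ alg_map A f, alg_map A f', cancel f f', forall y, D (f y) &
        forall x, D x -> f (f' x) = x].
  apply: (@alg_iso_full A hA D m) => // y; apply: K_D.
  by rewrite /K lead_ones.
have [r [r' [ar ar' rK rQ r'K]]] : exists f f' : bseq -> bseq,
    [/\ alg_map A f, alg_map A f', cancel f f', forall y, ~~ Q (f y) &
        forall x, ~~ Q x -> f (f' x) = x].
  (* the cylinder [1^L 0] codes no chain, since chains have at most [L] points *)
  apply: (@alg_iso_full A hA (fun y => ~~ Q y) L); first exact: (alg_neg hA).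
  move=> y; rewrite /Q /Q1.
  suff -> : lead L (ones L y) = L by rewrite ltnn.
  case: (lead_case L (ones L y)) => // -[i iL [z eqz]].
  have : lead L.+1 (ones L y) = i by rewrite eqz lead_ones// ltnW.
  by rewrite lead_ones// => Li; rewrite -Li ltnn in iL.
pose h y := if Q y then let y1 := shift (lead L y).+1 y in
    iter (lead L y1) T (shift (lead L y1).+1 y1) else f (r' y).
pose h' x := if D x then r (f' x) else
  let b := iter (j x) T' x in ones (e b) (ones (j x) b).
have h_enc b i : base b -> i <= e b -> ~~ D0 b ->
    h (ones (e b) (ones i b)) = iter i T b.
  move=> bb ie nD; have [eL _ _] := eP b.
  rewrite /h Q_enc// lead_ones// shift_ones lead_ones ?(leq_ltn_trans ie)//.
  by rewrite shift_ones.
exists h, h'; split.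
- apply: (alg_map_if hA) => //; last exact: (alg_map_comp hA).
  apply: (@alg_map_cases A hA L (lead L) (fun k y =>
    let y1 := shift k.+1 y in iter (lead L y1) T (shift (lead L y1).+1 y1))).
  + exact: lead_le.
  + by move=> k; exact: (alg_lead hA).
  move=> k; apply: (@alg_map_comp A hA
    (fun y1 => iter (lead L y1) T (shift (lead L y1).+1 y1)));
    last exact: (alg_map_shift hA).
  apply: (@alg_map_cases A hA L (lead L) (fun i y => iter i T (shift i.+1 y))).
  + exact: lead_le.
  + by move=> i; exact: (alg_lead hA).
  move=> i; apply: (@alg_map_comp A hA (iter i T)); last exact: (alg_map_shift hA).
  exact: (alg_map_iter hA).
- apply: (alg_map_if hA) => //; first exact: (alg_map_comp hA).
  apply: (@alg_map_cases A hA L j (fun k x =>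
    let b := iter k T' x in ones (e b) (ones k b))) => // k.
  apply: (@alg_map_comp A hA (fun b => ones (e b) (ones k b)));
    last exact: (alg_map_iter hA).
  apply: (@alg_map_cases A hA L e (fun i b => ones i (ones k b))) => // i.
  by apply: (alg_map_comp hA); exact: (alg_map_ones hA).
- move=> y; case: (boolP (Q y)) => Qy; last first.
    by rewrite /h (negbTE Qy) /h' fD fK r'K.
  have := Qy; rewrite /Q /Q1; set k := lead L y; set y1 := shift k.+1 y.
  set i := lead L y1; set b := shift i.+1 y1 => /and5P[kL ik bb /eqP eb nD].
  have iL : i < L by exact: leq_ltn_trans kL.
  have y1E : ones i b = y1 by apply: ones_lead.
  have yE : ones k y1 = y by apply: ones_lead.
  have -> : h y = iter i T b by rewrite /h Qy.
  have ie : i <= e b by rewrite eb.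
  by rewrite /h' D_iter// (negbTE nD) j_iter// iterT'K eb y1E.
- move=> x; rewrite {1}/h'; case: ifPn => Dx.
    by rewrite /h (negbTE (rQ _)) rK f'K.
  by rewrite h_enc.
move=> x xK xE.
have nD : ~~ D x by apply/negP => /D_window[a /xK /negP].
rewrite /h' (negbTE nD) /=; set b := iter (j x) T' x.
have bb : base b by exact: base_j.
have bE : iter (j x) T b = x by exact: iterTK.
have := j_le_e x; rewrite -/b leq_eqVlt => /orP[/eqP je|je]; last first.
  by rewrite model_lt// h_enc// iterS bE.
rewrite je model_last h_enc //=.
have Ex : E x by have [_ + _] := eP b; rewrite -je bE.
have [_ Ej _] := jP x.
by rewrite -[in RHS](xE Ex _ Ej) /= T'K.
Qed.

End Castle.

(** * Markers *)

Section Markers.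
Context (T T' : bseq -> bseq) (TK : cancel T T') (T'K : cancel T' T).
Context (n N : nat).

(** The orbit of [z] does not return to the [n]-prefix of [z] at the times
    [1, ..., i]: at resolution [n], the return time of [z] exceeds [i]. *)
Definition avoid (i : nat) (z : bseq) : bool :=
  all (fun k => prefix n (iter k T z) != prefix n z) (iota 1 i).

(** A greedy choice of markers: the points with prefix in the list [ws] are
    considered word after word, and a point becomes a marker unless there is
    already a marker on its orbit at a distance [i < N] which is smaller than
    its return time at resolution [n]. *)
Fixpoint marker (ws : seq (seq bool)) (x : bseq) : bool :=
  if ws is w :: ws' then
    marker ws' x || (prefix n x == w) &&
      ~~ has (fun i => avoid i x &&
                (marker ws' (iter i T x) || marker ws' (iter i T' x)))
             (iota 1 N.-1)
  else false.

(** Before time [N], the orbit of [z] returns to the [n]-prefix of [z] at a point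
    other than [z]. *)
Definition fake_return (z : bseq) : bool :=
  has (fun k => (prefix n (iter k T z) == prefix n z) && ~~ `[< iter k T z = z >])
      (iota 1 N.-1).

(** A fake return occurs at [T^i x] for some [i] with [- N <= i < N]. *)
Definition bad (x : bseq) : bool :=
  has (fun a => fake_return (iter a T (iter N T' x))) (iota 0 N.*2).

Let in_iota1 k : (k \in iota 1 N.-1) = (0 < k < N).
Proof. by rewrite mem_iota; lia. Qed.

Let fake_returnPn z k : ~~ fake_return z -> 0 < k < N ->
  prefix n (iter k T z) = prefix n z -> iter k T z = z.
Proof.
move=> /hasPn fz kN pz; apply: contrapT => /asboolPn kz.
by have := fz k; rewrite in_iota1 => /(_ kN); rewrite pz eqxx kz.
Qed.

Let avoidP i z k : avoid i z -> 0 < k <= i -> prefix n (iter k T z) <> prefix n z.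
Proof. by move=> /allP h ki; apply/eqP/h; rewrite mem_iota; lia. Qed.

Lemma avoid_le i k z : i <= k -> avoid k z -> avoid i z.
Proof.
move=> ik /avoidP h; apply/allP => j; rewrite mem_iota => ji.
by apply/eqP/h; lia.
Qed.

(** When every prefix is considered, every orbit meets the markers in every time
    interval of length [2 N]. *)
Lemma marker_cover ws z : prefix n z \in ws ->
  exists2 c, c < N.*2.+1 & marker ws (iter c T (iter N T' z)).
Proof.
elim: ws => // w ws IHws; rewrite inE orbC.
case: (boolP (_ \in ws)) => [/IHws[c cN mc] _|_ /= zw].
  by exists c => //=; rewrite mc.
have TN i : i <= N -> iter i T' z = iter (N - i) T (iter N T' z).
  by move=> iN; rewrite (iter_cancel_le _ T'K) ?leq_subr// subKn.
case: (boolP (has (fun i => avoid i z &&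
   (marker ws (iter i T z) || marker ws (iter i T' z))) (iota 1 N.-1))) => [|nh].
  move=> /hasP[i]; rewrite in_iota1 => iN /andP[_ /orP[] mi].
    exists (i + N); first by lia.
    by rewrite iterD (iter_cancel_le _ T'K)// subnn /= mi.
  exists (N - i); first by lia.
  by rewrite -TN; [rewrite /= mi|lia].
exists N; first by lia.
by rewrite (iter_cancel_le _ T'K)// subnn /= zw nh orbT.
Qed.

Lemma marker_sep ws z i : 0 < i < N -> avoid i z -> ~~ fake_return (iter i T z) ->
  marker ws z -> ~~ marker ws (iter i T z).
Proof.
move=> iN az fz; elim: ws => //= w ws IHws.
case/orP => [mz|/andP[/eqP zw nz]]; apply/norP; split.
- exact: IHws.
- rewrite negb_and negbK; apply/orP; right; apply/hasP; exists i; rewrite ?in_iota1//.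
  rewrite (iter_cancel_le _ TK)// subnn mz orbT andbT.
  apply/allP => k; rewrite mem_iota => ki; apply/eqP => e.
  have kN : 0 < k < N by lia.
  have := fake_returnPn fz kN e; rewrite -iterD addnC iterD.
  move=> /(congr1 (iter i T')); rewrite !(iter_cancel_le _ TK)// subnn /= => kz.
  by have := @avoidP _ _ k az; rewrite kz => /(_ _ erefl); apply; lia.
- apply/negP => mi; move: nz => /hasPn /(_ i); rewrite in_iota1 => /(_ iN).
  by rewrite az mi.
- apply/negP => /andP[/eqP iw _].
  by apply: (@avoidP _ _ i az); [lia|rewrite iw zw].
Qed.

Let iter_back s x : s <= N -> iter s T' x = iter (N - s) T (iter N T' x).
Proof. by move=> sN; rewrite (iter_cancel_le _ T'K) ?leq_subr// subKn. Qed.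

Let good x i s : ~~ bad x -> i < N -> s <= N -> ~~ fake_return (iter i T (iter s T' x)).
Proof.
move=> /hasPn gx iN sN; rewrite iter_back// -iterD; apply: gx.
by rewrite mem_iota; lia.
Qed.

(** On an orbit with a return before time [N], and without fake returns nearby,
    the markers lie at a single point. *)
Lemma marker_return ws x s r : ~~ bad x -> s < N ->
  marker ws (iter s T' x) -> marker ws (iter s T' (iter r T' x)) ->
  ~~ avoid N.-1 (iter s T' x) -> iter r T' x = x.
Proof.
move=> gx sN; set z := iter s T' x => mz mrz nz.
have sinj : injective (iter s T').
  by apply: (can_inj (g := iter s T)) => y; rewrite (iter_cancel_le _ T'K)// subnn.
apply: sinj; rewrite -/z; move: mrz.
have -> : iter s T' (iter r T' x) = iter r T' z by rewrite -!iterD addnC.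
move=> mrz.
have ex_d : exists d, (0 < d < N) && (prefix n (iter d T z) == prefix n z).
  move: nz; rewrite -has_predC => /hasP[d]; rewrite in_iota1 => dN /=.
  by rewrite negbK => ed; exists d; rewrite dN.
(* by minimality, [d] is the exact period of [z] *)
case: (ex_minnP ex_d) => d /andP[dN /eqP pd] dmin.
have dz : iter d T z = z.
  by apply: fake_returnPn => //; apply: (@good x 0) => //; lia.
have d'z : iter d T' z = z by rewrite -{1}dz (iter_cancel_le _ TK)// subnn.
have per q : iter (q * d) T' z = z.
  by elim: q => // q IHq; rewrite mulSn iterD IHq.
have rz : iter r T' z = iter (r %% d) T' z.
  by rewrite {1}(divn_eq r d) addnC iterD per.
have [r0|r_gt0] := posnP (r %% d); first by rewrite rz r0.
have rd : r %% d < d by rewrite ltn_mod; lia.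
have rT : iter r T' z = iter (d - r %% d) T z.
  by rewrite rz -{1}dz (iter_cancel_le _ TK)// ltnW.
suff : ~~ marker ws (iter (d - r %% d) T z) by rewrite -rT mrz.
apply: marker_sep => //; first by lia.
  apply/allP => k; rewrite mem_iota => kd; apply/negP => /eqP pk.
  have kN : 0 < k < N by lia.
  by have := dmin k; rewrite pk eqxx kN => /(_ isT); lia.
by apply: good => //; lia.
Qed.

(** On an orbit without such a return, distinct markers are at distance at least
    [N]. *)
Lemma marker_disjoint ws x s t : ~~ bad x -> s < t < N ->
  marker ws (iter s T' x) -> marker ws (iter t T' x) ->
  ~~ avoid N.-1 (iter t T' x).
Proof.
move=> gx stN ms mt; apply/negP => at_; move: ms.
have -> : iter s T' x = iter (t - s) T (iter t T' x).
  by rewrite (iter_cancel_le _ T'K) ?leq_subr// subKn//; lia.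
apply/negP; apply: marker_sep => //; first by lia.
  by apply: avoid_le at_; lia.
by apply: good => //; lia.
Qed.

Lemma alg_avoid A (hA : coordinate_algebra A) i : alg_map A T -> A (avoid i).
Proof.
move=> aT; apply: (alg_all hA) => k; apply: (alg_neg hA).
apply: (alg_prefix_eq hA); first exact: (alg_map_iter hA).
by move=> l; exact: (alg_coord hA).
Qed.

Lemma alg_marker A (hA : coordinate_algebra A) ws :
  alg_map A T -> alg_map A T' -> A (marker ws).
Proof.
move=> aT aT'; elim: ws => [|w ws IHws] /=; first exact: (alg_const hA).
apply: (alg_or hA) => //; apply: (alg_and hA).
  by apply: (alg_prefix_const hA) => l; exact: (alg_coord hA).
apply: (alg_neg hA); apply: (alg_has hA) => i; apply: (alg_and hA).
  exact: alg_avoid.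
by apply: (alg_or hA); apply: (alg_comp hA IHws); exact: (alg_map_iter hA).
Qed.

End Markers.

Definition words (n : nat) : seq (seq bool) :=
  [seq val t | t <- enum {: n.-tuple bool}].

Lemma mem_words n x : prefix n x \in words n.
Proof.
apply/mapP; exists (Tuple (introT eqP (size_mkseq x n))) => //.
by rewrite mem_enum.
Qed.

(** * Clopen and Borel predicates *)

Lemma cantor_cvg (F : set_system cantor_space) (x : cantor_space) : Filter F ->
  (forall i, F [set y | y i = x i]) -> F --> x.
Proof.
move=> FF Fx; apply/cvg_sup => i U [V] [[W oW <-] Wx] VU.
apply: filterS (Fx i) => y yi; apply: VU.
by rewrite /= yi.
Qed.

(** The cylinders form a base. *)
Lemma nbhs_cantor_prefix (x : cantor_space) (U : set cantor_space) :
  nbhs x U -> exists n, forall y : cantor_space, prefix n y = prefix n x -> U y.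
Proof.
move=> Ux; apply: contrapT => /forallNP nU.
have /choice[y yP] : forall n, exists y : cantor_space,
    prefix n y = prefix n x /\ ~ U y.
  move=> n; apply: contrapT => /forallNP ny; apply: (nU n) => y yx.
  by apply: contrapT => Uy; apply: (ny y).
have yx : y @ \oo --> x.
  apply: cantor_cvg => i; exists i.+1 => // n /= ni.
  have [/eq_in_map + _] := yP n; apply.
  by rewrite mem_iota.
have [n _ /(_ n (leqnn n)) /=] := yx _ Ux.
by have [] := yP n.
Qed.

Lemma open_coord n b : open [set x : cantor_space | x n = b].
Proof.
have -> : [set x : cantor_space | x n = b] =
  (fun x : cantor_space => x n) @^-1` [set b] by [].
apply: open_comp; last exact: discrete_open.
by move=> x _; exact: (@proj_continuous nat (fun=> bool) n).
Qed.

Definition clopen_pred (P : bseq -> bool) : Prop :=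
  open [set x : cantor_space | P x] /\ open [set x : cantor_space | ~~ P x].

Definition borel_pred (P : bseq -> bool) : Prop :=
  measurable ([set x | P x] : set (borel cantor_space)).

Lemma clopen_map_continuous (f : cantor_space -> cantor_space) :
  alg_map clopen_pred f <-> continuous f.
Proof.
split=> [cf x|cf n].
  apply: cantor_cvg => i; have [ o1 o2] := cf i.
  case fx: (f x i).
    by apply: (open_nbhs_nbhs (conj o1 _)).
  rewrite (_ : [set y | _] = [set y | ~~ y i]) ; last first.
    by apply/seteqP; split => y /=; case: (y i).
  by apply: (open_nbhs_nbhs (conj o2 _)) => /=; rewrite fx.
split.
  apply: (@open_comp _ _ f [set x | x n = true]); last exact: open_coord.
  by move=> x _; exact: cf.
rewrite (_ : [set _ | _] = f @^-1` [set x | x n = false]); last first.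
  by apply/seteqP; split => y /=; case: (f y n).
by apply: open_comp => [x _|]; [exact: cf|exact: open_coord].
Qed.

Lemma clopen_algebra : coordinate_algebra clopen_pred.
Proof.
split.
- move=> n; split; first exact: (open_coord n true).
  rewrite (_ : [set _ | _] = [set x | x n = false]); first exact: open_coord.
  by apply/seteqP; split => y /=; case: (y n).
- move=> P [ oP onP]; split => //.
  rewrite (_ : [set _ | _] = [set x | P x])//.
  by apply/seteqP; split => x /=; rewrite negbK.
- move=> P Q [ oP onP] [ oQ onQ]; split.
    rewrite (_ : [set _ | _] = [set x | P x] `&` [set x | Q x]); first exact: openI.
    by apply/seteqP; split => x /= /andP.
  rewrite (_ : [set _ | _] = [set x | ~~ P x] `|` [set x | ~~ Q x]); first exact: openU.
  by apply/seteqP; split => x /=; rewrite negb_and => /orP.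
- move=> P f [ oP onP] /clopen_map_continuous cf.
  have oc (D : set cantor_space) : open D ->
      open ((f : cantor_space -> cantor_space) @^-1` D).
    by move=> oD; apply: open_comp => // x _; exact: cf.
  by split; [exact: (oc _ oP)|exact: (oc _ onP)].
Qed.

Lemma borel_predC P : borel_pred P -> borel_pred (fun x => ~~ P x).
Proof.
move=> mP; rewrite /borel_pred (_ : [set _ | _] = ~` [set x | P x]).
  exact: measurableC.
by apply/seteqP; split => x /= /negP.
Qed.

Lemma borel_predI P Q :
  borel_pred P -> borel_pred Q -> borel_pred (fun x => P x && Q x).
Proof.
move=> mP mQ.
rewrite /borel_pred (_ : [set _ | _] = [set x | P x] `&` [set x | Q x]).
  exact: measurableI.
by apply/seteqP; split => x /= /andP.
Qed.

Lemma borel_pred_coord n : borel_pred (fun x => x n).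
Proof. by apply: sub_sigma_algebra; exact: (open_coord n true). Qed.

(** An open set is the union of the cylinders it contains, and there are only
    countably many cylinders. *)
Lemma borel_map_measurable (f : cantor_space -> cantor_space) :
  alg_map borel_pred f <->
  measurable_fun [set: borel cantor_space]
    (f : borel cantor_space -> borel cantor_space).
Proof.
split=> [bf|mf n]; last first.
  have := mf measurableT [set x | x n] (borel_pred_coord n).
  by rewrite setTI.
apply: (@measurability _ _ (borel cantor_space) (borel cantor_space) setT f
  (@open cantor_space)) => // _ [U oU <-].
rewrite setTI.
pose S (w : seq bool) : set (borel cantor_space) := [set x |
  (forall y : cantor_space, prefix (size w) y = w -> U y) /\
  prefix (size w) (f x) = w].
have -> : f @^-1` U = \bigcup_w S w.
  apply/seteqP; split=> [x /= Ux|x [w _ [/= wU wx]]]; last exact: wU.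
  have [n nU] := nbhs_cantor_prefix (open_nbhs_nbhs (conj oU Ux)).
  by exists (prefix n (f x)) => //; rewrite /S /= size_mkseq.
apply: countable_bigcupT_measurable; first exact: countableP.
move=> w.
have [wU|wU] := pselect (forall y : cantor_space, prefix (size w) y = w -> U y);
  last by rewrite (_ : S w = set0) //; apply/seteqP; split => x // -[].
rewrite (_ : S w =
  [set x | all (fun i => f x i == nth false w i) (iota 0 (size w))]).
  elim: (iota 0 (size w)) => [|i s IHs] /=.
    by rewrite set_true; exact: measurableT.
  apply: borel_predI => //; case: (nth false w i).
    by have := bf i; congr borel_pred; apply/funext => x; rewrite eqb_id.
  by have := borel_predC (bf i); congr borel_pred; apply/funext => x; rewrite eqbF_neg.
apply/seteqP; split=> x /=.
  move=> [_ wx]; apply/allP => i; rewrite mem_iota => iw.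
  by rewrite -[in nth _ _ _]wx nth_mkseq.
move=> /allP h; split=> //.
apply: (@eq_from_nth _ false); rewrite size_mkseq // => i iw.
by rewrite nth_mkseq//; apply/eqP/h; rewrite mem_iota.
Qed.

Lemma borel_algebra : coordinate_algebra borel_pred.
Proof.
split; [exact: borel_pred_coord|exact: borel_predC|exact: borel_predI|].
move=> P f bP /borel_map_measurable mf.
by have := mf measurableT _ bP; rewrite setTI.
Qed.

Lemma clopen_borel P : clopen_pred P -> borel_pred P.
Proof. by move=> [ oP _]; exact: sub_sigma_algebra. Qed.

Lemma borel_pred_eq (f g : bseq -> bseq) :
  alg_map borel_pred f -> alg_map borel_pred g ->
  borel_pred (fun x => `[< f x = g x >]).
Proof.
move=> bf bg; rewrite /borel_pred.
rewrite (_ : [set _ | _] = \bigcap_n [set x | prefix n (f x) == prefix n (g x)]).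
  apply: bigcapT_measurable => n.
  exact: (alg_prefix_eq borel_algebra).
apply/seteqP; split => [x /= /asboolP fg n _|x fg /=]; first by rewrite /= fg.
apply/asboolP/funext => n; have /eqP/eq_in_map := fg n.+1 I.
by apply; rewrite mem_iota /= add0n ltnSn.
Qed.

(** * Sets of small measure *)

Section SmallSets.
Local Open Scope ring_scope.
Local Open Scope ereal_scope.
Context {R : realType} (mu : {measure set (borel cantor_space) -> \bar R}).
Hypothesis mu_fin : mu setT < +oo.

(** Continuity from above. *)
Lemma small_decreasing (F : nat -> bseq -> bool) (d : R) : (0 < d)%R ->
  (forall n, borel_pred (F n)) -> (forall n x, F n.+1 x -> F n x) ->
  (forall x, exists n, ~~ F n x) -> exists n, mu [set x | F n x] < d%:E.
Proof.
move=> d0 bF decF F0.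
have F00 : \bigcap_n [set x | F n x] = set0 :> set (borel cantor_space).
  by apply/seteqP; split=> x // Fx; have [n /negP] := F0 x; apply; exact: Fx.
have : mu \o (fun n => [set x | F n x]) @ \oo --> mu (\bigcap_n [set x | F n x]).
  apply: nonincreasing_cvg_mu => //.
  - by apply: le_lt_trans mu_fin; apply: le_measure; rewrite ?inE//; exact: bF.
  - by rewrite F00.
  - by apply/nonincreasing_seqP => n; apply/subsetPset => x; exact: decF.
rewrite F00 measure0 => cv.
have : \forall n \near \oo, mu [set x | F n x] < d%:E.
  apply: (cv [set y | y < d%:E]); apply: open_nbhs_nbhs.
  by split; [exact: open_ereal_lt_ereal|rewrite /= lte_fin].
by move=> [n _ /(_ n (leqnn n))]; exists n.
Qed.

(** One of [N] disjoint sets has measure at most [mu setT / N]. *)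
Lemma small_disjoint N (G : nat -> bseq -> bool) (d : R) :
  (forall s, borel_pred (G s)) ->
  (forall s t x, (s < t < N)%N -> G s x -> ~~ G t x) ->
  mu setT < (N%:R * d)%:E -> exists2 s, (s < N)%N & mu [set x | G s x] < d%:E.
Proof.
move=> bG dG muN; apply: contrapT => nex.
have Gd s : (s < N)%N -> d%:E <= mu [set x | G s x].
  by move=> sN; rewrite leNgt; apply/negP => h; apply: nex; exists s.
have : mu (\big[setU/set0]_(s < N) [set x | G s x]) <= mu setT.
  apply: le_measure; rewrite ?inE//.
  by apply: bigsetU_measurable => s _; exact: bG.
rewrite measure_bigsetU_ord => [|s|]; last 2 first.
- exact: bG.
- apply/trivIsetP => s t _ _ st; apply/seteqP; split => // x [/= Gs Gt].
  have : (s != t :> nat) by []; rewrite neq_ltn => /orP[] lt.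
  + by have := @dG s t x; rewrite lt ltn_ord Gt => /(_ isT Gs).
  + by have := @dG t s x; rewrite lt ltn_ord Gs => /(_ isT Gt).
apply/negP; rewrite -ltNge; apply: lt_le_trans muN _.
apply: (@le_trans _ _ (\sum_(s < N) d%:E)); last by apply: lee_sum => s _; exact: Gd.
by rewrite sumEFin sumr_const card_ord mulr_natl lexx.
Qed.

End SmallSets.

Lemma decreasing_hasN (I : Type) (s : seq I) (P : nat -> I -> bool) :
  (forall n i, P n.+1 i -> P n i) -> (forall i, exists n, ~~ P n i) ->
  exists n, ~~ has (P n) s.
Proof.
move=> decP P0.
have decP' m n i : m <= n -> P n i -> P m i.
  by move=> /subnKC <-; elim: (n - m) => [|k IHk]; rewrite ?addn0// addnS => /decP.
elim: s => [|i s [n ns]]; first by exists 0.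
have [k ki] := P0 i; exists (maxn k n) => /=; rewrite negb_or; apply/andP; split.
  by apply: contra ki; apply: decP'; rewrite leq_maxl.
by apply: contra ns; apply: sub_has => j; apply: decP'; rewrite leq_maxr.
Qed.

Lemma prefix_le n k (x y : bseq) :
  n <= k -> prefix k x = prefix k y -> prefix n x = prefix n y.
Proof.
move=> nk /eq_in_map xy; apply/eq_in_map => i; rewrite mem_iota => ni; apply: xy.
by rewrite mem_iota; lia.
Qed.

Lemma prefix_inj (x y : bseq) : (forall n, prefix n x = prefix n y) -> x = y.
Proof.
move=> xy; apply/funext => n; have /eq_in_map := xy n.+1; apply.
by rewrite mem_iota /= add0n ltnSn.
Qed.

(** The bad sets decrease to the empty set as the resolution increases. *)
Lemma badS T T' n N x : bad T T' n.+1 N x -> bad T T' n N x.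
Proof.
apply: sub_has => a; apply: sub_has => k /andP[/eqP e ->]; rewrite andbT.
by apply/eqP; apply: prefix_le e.
Qed.

Lemma badN T T' N x : exists n, ~~ bad T T' n N x.
Proof.
apply: (@decreasing_hasN _ _
  (fun n a => fake_return T n N (iter a T (iter N T' x)))).
  move=> n a; apply: sub_has => k /andP[/eqP e ->]; rewrite andbT.
  by apply/eqP; apply: prefix_le e.
move=> a; set z := iter a _ _.
apply: (@decreasing_hasN _ _ (fun n k => (prefix n (iter k T z) == prefix n z) &&
  ~~ `[< iter k T z = z >])).
  move=> n k /andP[/eqP e ->]; rewrite andbT.
  by apply/eqP; apply: prefix_le e.
move=> k; apply: contrapT => /forallNP h.
have /negP : ~ ~~ ~~ `[< iter k T z = z >].
  by move=> hk; apply: (h 0); rewrite negb_and hk orbT.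
rewrite negbK => /asboolPn; apply.
by apply: prefix_inj => n; apply/eqP; have /negP := h n; rewrite negbK => /andP[].
Qed.

Lemma lead_true L : lead L (fun=> true) = L.
Proof.
elim: L => // L {2}<-; rewrite -lead_bcons_true; congr lead.
by apply/funext => -[].
Qed.

Lemma lead_lt_eq L M y : lead L y < L -> L <= M -> lead M y = lead L y.
Proof.
move=> lL LM; rewrite -{1}(ones_lead lL) lead_ones //.
exact: leq_trans LM.
Qed.

Lemma lead_eqN y : y <> (fun=> true) -> exists m, lead m y != m.
Proof.
move=> y1; apply: contrapT => /forallNP h; apply: y1; apply/funext => k.
have /negP := h k.+1; rewrite negbK => /eqP lk; apply: contraTT isT => yk.
have : has (fun i => ~~ y i) (iota 0 k.+1).
  by apply/hasP; exists k => //; rewrite mem_iota /= add0n ltnSn.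
by rewrite has_find size_iota -/(lead _ _) lk ltnn.
Qed.

Lemma measure_pred_or (R : realType)
    (mu : {measure set (borel cantor_space) -> \bar R}%R) P Q :
  borel_pred P -> borel_pred Q ->
  (mu [set x | P x || Q x] <= mu [set x | P x] + mu [set x | Q x])%E.
Proof.
move=> bP bQ.
rewrite (_ : [set _ | _] = [set x | P x] `|` [set x | Q x]); first exact: measureU2.
by apply/seteqP; split => x /= /orP.
Qed.

(** * Approximation on the space of binary sequences *)

Section Approximation.
Local Open Scope ring_scope.
Local Open Scope nat_scope.
Context {R : realType} {A : (bseq -> bool) -> Prop} (hA : coordinate_algebra A).
Hypothesis A_borel : forall P, A P -> borel_pred P.

(** The error splits into three small sets: the chains that meet the cylinder
    [1^m 0], which are sacrificed to make room for the rest of [model]; the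
    points with a fake return nearby; and the cut points on orbits without short
    returns. *)
Theorem cantor_approximation (T T' : bseq -> bseq) (e : R)
    (mu : {measure set (borel cantor_space) -> \bar R}) :
  alg_map A T -> alg_map A T' -> cancel T T' -> cancel T' T ->
  (mu setT < +oo)%E -> (0 < e)%R ->
  exists h h' Z, [/\ alg_map A h, alg_map A h', cancel h h', cancel h' h &
    [/\ borel_pred Z, (mu [set x | Z x] < e%:E)%E &
        forall x, ~~ Z x -> h (model (h' x)) = T x]].
Proof.
move=> aT aT' TK T'K mu_fin e0.
have bT : alg_map borel_pred T by move=> n; exact: A_borel.
have bT' : alg_map borel_pred T' by move=> n; exact: A_borel.
have hB := borel_algebra.
pose d : R := (e / 3)%R.
have d0 : (0 < d)%R by rewrite divr_gt0.
have [N muN] : exists N : nat, (mu setT < (N%:R * d)%:E)%E.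
  exists (Num.bound (fine (mu setT) / d)%R).
  rewrite -[ltLHS]fineK ?ge0_fin_numE// lte_fin -ltr_pdivrMr//.
  apply: le_lt_trans (archi_boundP _); rewrite ?ler_norm//.
  by rewrite divr_ge0// ?fine_ge0// ltW.
have bbad n : borel_pred (bad T T' n N).
  apply: (alg_has hB) => a.
  have bz : alg_map borel_pred (fun x => iter a T (iter N T' x)).
    by apply: (alg_map_comp hB); exact: (alg_map_iter hB).
  apply: (alg_comp hB (P := fake_return T n N)) => //; apply: (alg_has hB) => k.
  have bk : alg_map borel_pred (fun x => iter k T x) by exact: (alg_map_iter hB).
  have bid : alg_map borel_pred id by move=> i; exact: (alg_coord hB).
  apply: (alg_and hB); first exact: (alg_prefix_eq hB).
  by apply: (alg_neg hB); exact: borel_pred_eq.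
have [n bad_d] : exists n, (mu [set x | bad T T' n N x] < d%:E)%E.
  apply: (small_decreasing mu_fin d0) => // [n x|]; first exact: badS.
  exact: badN.
pose W := marker T T' n N (words n).
have aW : A W by exact: alg_marker.
pose G s x := [&& ~~ bad T T' n N x, W (iter s T' x) & avoid T n N.-1 (iter s T' x)].
have bG s : borel_pred (G s).
  apply: (alg_and hB); first exact: (alg_neg hB).
  apply: (alg_and hB).
    by apply: (alg_comp hB (A_borel aW)); exact: (alg_map_iter hB).
  have ba : borel_pred (avoid T n N.-1) by exact: alg_avoid.
  by apply: (alg_comp hB ba); exact: (alg_map_iter hB).
have [s sN G_d] : exists2 s, (s < N)%N & (mu [set x | G s x] < d%:E)%E.
  (* shifting the markers by [s < N] gives [N] disjoint candidates *)
  apply: small_disjoint muN => // s t x stN /and3P[gx ms _].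
  apply/negP => /and3P[_ mt]; apply/negP.
  exact: (marker_disjoint TK T'K gx stN ms mt).
(* the orbit of every point meets the shifted markers before time [L] *)
pose L := N * 3.
(* [F m] only asks for [m] leading ones, so that it decreases with [m]; the point
   [1^oo] has to be removed for the intersection to be empty *)
pose F m x := has (fun a => (lead m (iter a T (iter L T' x)) == m) &&
  ~~ `[< iter a T (iter L T' x) = (fun=> true) >]) (iota 0 L.*2.+1).
have bF m : borel_pred (F m).
  apply: (alg_has hB) => a.
  have bz : alg_map borel_pred (fun x => iter a T (iter L T' x)).
    by apply: (alg_map_comp hB); exact: (alg_map_iter hB).
  apply: (alg_comp hB
    (P := fun y => (lead m y == m) && ~~ `[< y = (fun=> true) >])) => //.
  apply: (alg_and hB); first exact: (alg_lead hB).
  apply: (alg_neg hB); apply: borel_pred_eq => i; first exact: (alg_coord hB).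
  exact: (alg_const hB).
have [m F_d] : exists m, (mu [set x | F m x] < d%:E)%E.
  have decF m a x : (lead m.+1 (iter a T (iter L T' x)) == m.+1) &&
      ~~ `[< iter a T (iter L T' x) = (fun=> true) >] ->
    (lead m (iter a T (iter L T' x)) == m) &&
      ~~ `[< iter a T (iter L T' x) = (fun=> true) >].
    move=> /andP[/eqP lm ->]; rewrite andbT; apply: contraTT isT => lt_m.
    have {}lt_m : lead m (iter a T (iter L T' x)) < m.
      by rewrite ltn_neqAle lt_m lead_le.
    by have := lead_lt_eq lt_m (leqnSn m); lia.
  apply: (small_decreasing mu_fin d0) => // [m x|x].
    by apply: sub_has => a; exact: decF.
  apply: decreasing_hasN => [m a|a]; first exact: decF.
  case: (boolP `[< iter a T (iter L T' x) = (fun=> true) >]) => [_|/asboolPn ya].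
    by exists 0; rewrite andbF.
  by have [m lm] := lead_eqN ya; exists m; rewrite negb_and lm.
have hit x : exists2 i, i < L & W (iter s T' (iter i T x)).
  have [c cN Wc] := marker_cover T'K N (mem_words n (iter N T x)).
  exists (c + s); first by rewrite /L; lia.
  move: Wc; rewrite (iter_cancel_le _ TK)// subnn /=.
  by rewrite (iter_cancel_le _ TK) ?leq_addl// addnK.
have aE : A (fun x => W (iter s T' x)).
  by apply: (alg_comp hA aW); exact: (alg_map_iter hA).
have [h [h' [ah ah' hK h'K hT]]] := castle_conjugate hA aT aT' TK T'K aE hit m.
exists h, h', (fun x => [|| F m x, bad T T' n N x | G s x]); split => //; split.
- by do 2!apply: (alg_or hB) => //.
- have -> : e = (d + (d + d))%R by rewrite /d; lra.
  rewrite !EFinD; apply: le_lt_trans (measure_pred_or mu (bF m) _) _.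
    exact: (alg_or hB).
  apply: lteD => //; apply: le_lt_trans (measure_pred_or mu (bbad n) (bG s)) _.
  exact: lteD.
move=> x /norP[nF /norP[nb nG]]; apply: hT => [a aL|Wx r Wr].
  have /hasPn/(_ a) : ~~ F m x := nF; rewrite mem_iota ltnS => /(_ aL).
  apply: contra => /eqP lm; apply/andP; split.
    have := lead_le m (iter a T (iter L T' x)); rewrite leq_eqVlt => /orP[//|lt_m].
    by have := lead_lt_eq lt_m (leqnSn m); lia.
  by apply/negP => /asboolP y1; move: lm; rewrite y1 lead_true; lia.
apply: (marker_return TK T'K nb sN Wx Wr).
by move: nG; rewrite /G nb Wx.
Qed.

End Approximation.

(** * Transfer to a Cantor set *)

Lemma continuous_borel (Y Z : ptopologicalType) (f : Y -> Z) : continuous f ->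
  measurable_fun [set: borel Y] (f : borel Y -> borel Z).
Proof.
move=> cf; apply: (@measurability _ _ (borel Y) (borel Z) setT f (@open Z)) => //.
move=> _ [U oU <-]; rewrite setTI; apply: sub_sigma_algebra.
by apply: open_comp => // x _; exact: cf.
Qed.

Section Transfer.
Context {X : cantorSetType} (f : X -> cantor_space) (g : cantor_space -> X).
Context (fK : cancel f g) (gK : cancel g f) (cf : continuous f) (cg : continuous g).

(** Transport of self-maps along the homeomorphism [f], and back. *)
Definition to_cantor (S : X -> X) : bseq -> bseq := fun x => f (S (g x)).

Definition of_cantor (h : bseq -> bseq) : X -> X := fun x => g (h (f x)).

Lemma to_cantorK S : of_cantor (to_cantor S) =1 S.
Proof. by move=> x; rewrite /of_cantor /to_cantor !fK. Qed.

Lemma of_cantorK h : to_cantor (of_cantor h) = h.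
Proof. by apply/funext => x; rewrite /of_cantor /to_cantor !gK. Qed.

Lemma of_cantor_cancel h h' : cancel h h' -> cancel (of_cantor h) (of_cantor h').
Proof. by move=> hK x; rewrite /of_cantor gK hK fK. Qed.

Lemma to_cantor_cancel S S' : cancel S S' -> cancel (to_cantor S) (to_cantor S').
Proof. by move=> SK x; rewrite /to_cantor fK SK gK. Qed.

Lemma to_cantor_measurable (S : X -> X) :
  measurable_fun [set: borel X] (S : borel X -> borel X) ->
  alg_map borel_pred (to_cantor S).
Proof.
move=> mS; apply/borel_map_measurable.
exact: (measurableT_comp (continuous_borel cf)
  (measurableT_comp mS (continuous_borel cg))).
Qed.

Lemma of_cantor_measurable h : alg_map borel_pred h ->
  measurable_fun [set: borel X] (of_cantor h : borel X -> borel X).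
Proof.
move=> /borel_map_measurable mh.
exact: (measurableT_comp (continuous_borel cg)
  (measurableT_comp mh (continuous_borel cf))).
Qed.

Lemma to_cantor_continuous (S : X -> X) :
  continuous S -> alg_map clopen_pred (to_cantor S).
Proof.
move=> cS; apply/clopen_map_continuous => x.
apply: (@continuous_comp _ _ _ (fun y => S (g y)) f); last exact: cf.
by apply: continuous_comp; [exact: cg|exact: cS].
Qed.

Lemma of_cantor_continuous h :
  alg_map clopen_pred h -> continuous (of_cantor h).
Proof.
move=> /clopen_map_continuous ch x.
apply: (@continuous_comp X cantor_space X (fun y => h (f y)) g); last exact: cg.
by apply: (@continuous_comp X cantor_space cantor_space f h); [exact: cf|exact: ch].
Qed.

Definition aut_of_cantor h h' (hK : cancel h h') (h'K : cancel h' h)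
    (mh : alg_map borel_pred h) (mh' : alg_map borel_pred h') : borelAut X :=
  BorelAut (of_cantor_cancel hK) (of_cantor_cancel h'K)
    (of_cantor_measurable mh) (of_cantor_measurable mh').

(** The automorphism of [X] whose conjugacy classes are shown to be dense. *)
Definition model_aut : borelAut X := aut_of_cantor modelK model_invK
  (alg_map_fan borel_algebra (alg_map_cycle_ones borel_algebra) 0)
  (alg_map_fan borel_algebra (alg_map_uncycle_ones borel_algebra) 0).

Lemma model_aut_homeo (R : realType) : @homeo_set R X model_aut.
Proof.
split; apply: of_cantor_continuous; apply: (alg_map_fan clopen_algebra).
  exact: (alg_map_cycle_ones clopen_algebra).
exact: (alg_map_uncycle_ones clopen_algebra).
Qed.

(** Finitely many probability measures are handled at once through their sum,
    transported to the space of binary sequences. *)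
Theorem model_aut_approximation (R : realType) (A : (bseq -> bool) -> Prop)
    (S : borelAut X) n (mu : 'I_n.+1 -> probability (borel X) R) (e : R) :
  coordinate_algebra A -> (forall P, A P -> borel_pred P) ->
  alg_map A (to_cantor S) -> alg_map A (to_cantor (aut_inv S)) -> (0 < e)%R ->
  exists H : borelAut X, [/\ alg_map A (to_cantor H),
    alg_map A (to_cantor (aut_inv H)) &
    unif_nbhd S mu e (H * model_aut * H^-1)%g].
Proof.
move=> hA Ab aS aS' e0.
have mf := continuous_borel cf.
pose fm : {mfun borel X >-> borel cantor_space} :=
  HB.pack (f : borel X -> borel cantor_space)
    (isMeasurableFun.Build _ _ _ _ (f : borel X -> borel cantor_space) mf).
pose nu (k : nat) : {measure set (borel cantor_space) -> \bar R}%R :=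
  distribution (mu (inord k)) fm.
have nu_fin : (msum nu n.+1 setT < +oo)%E.
  rewrite /msum; apply: lte_sum_pinfty => k _.
  rewrite (_ : nu k setT = 1%E) ?ltry//.
  exact: (@probability_setT _ _ _ (distribution (mu (inord k)) fm)).
have [h [h' [Z [ah ah' hK h'K [bZ nuZ hZ]]]]] := cantor_approximation hA Ab aS aS'
  (to_cantor_cancel (@aut_funK _ S)) (to_cantor_cancel (@aut_invK _ S)) nu_fin e0.
have bh : alg_map borel_pred h by move=> k; exact: Ab.
have bh' : alg_map borel_pred h' by move=> k; exact: Ab.
exists (aut_of_cantor hK h'K bh bh'); split; rewrite ?of_cantorK// => i.
apply: le_lt_trans nuZ.
apply: (@le_trans _ _ (mu i (f @^-1` [set x | Z x]))).
  apply: le_measure; rewrite ?inE; first exact: disagreement_measurable.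
    by have := mf measurableT _ bZ; rewrite setTI.
  move=> x /= dx; apply: contrapT => /negP /hZ hx; apply: dx.
  rewrite /= /of_cantor /= !gK hx /to_cantor.
  by rewrite !fK.
rewrite [leRHS](_ : _ = \sum_(k < n.+1) nu k [set x | Z x])%E //.
rewrite (bigD1 i)//= inord_val.
by apply: leeDl; apply: sume_ge0 => k _; exact: measure_ge0.
Qed.

End Transfer.

Theorem theorem2p5 (R : realType) (X : cantorSetType) :
  rokhlin_property (unifAut R X) /\ rokhlin_property (unifHomeo R X).
Proof.
have [f [g [fK gK cf cg]]] := @cantor_homeomorphism X.
pose G := model_aut fK gK cf cg.
split.
  exists (G : unifAut R X) => O [S OS] oO.
  have /nbhs_unifP[n [mu [e [e0 subO]]]] : nbhs S O by exact: open_nbhs_nbhs.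
  have [H [_ _ HS]] := @model_aut_approximation X f g fK gK cf cg R borel_pred
    S n mu e borel_algebra (fun _ => id)
    (to_cantor_measurable cf cg (@aut_measurable _ S))
    (to_cantor_measurable cf cg (@inv_measurable _ S)) e0.
  by exists (H * G * H^-1)%g; split; [exact: subO|exists H].
have Gh : (G : unifAut R X) \in @homeo_set R X by rewrite inE; exact: model_aut_homeo.
pose G0 : unifHomeo R X := exist _ (G : unifAut R X) Gh.
exists G0 => O [S OS] [ O' oO' O'O].
have O'S : O' (val S) by move: OS; rewrite -O'O.
have /nbhs_unifP[n [mu [e [e0 subO]]]] : nbhs (val S) O' by exact: open_nbhs_nbhs.
have [cS cS'] : @homeo_set R X (val S) by have := valP S; rewrite inE.
have [H [aH aH' HS]] := @model_aut_approximation X f g fK gK cf cg R clopen_pred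
    (val S) n mu e clopen_algebra clopen_borel (to_cantor_continuous cf cg cS)
    (to_cantor_continuous cf cg cS') e0.
have Hh : (H : unifAut R X) \in @homeo_set R X.
  rewrite inE; split.
    by have := of_cantor_continuous cf cg aH; rewrite (funext (to_cantorK fK _)).
  by have := of_cantor_continuous cf cg aH'; rewrite (funext (to_cantorK fK _)).
pose H0 : unifHomeo R X := exist _ (H : unifAut R X) Hh.
exists (H0 * G0 * H0^-1)%g; split; last by exists H0.
by rewrite -O'O; exact: subO.
Qed.
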